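(* Let $\{\phi_e\}_{e\in E}$ be a CIFS on $X\subset\mathbb{R}^d$, $d\in\{1,2\}$, with finitely irreducible incidence matrix $A$ and strongly regular potential $f$, and consider the random CIFS $\phi_e^\lambda=\lambda_0\phi_e$, $e\in E$, $\lambda\in\Lambda=\mathcal{Z}^{\mathbb{Z}}$, where $\mathcal{Z}=\{z_1,\ldots,z_a\}$ is finite. Let $\lambda\in\Lambda$ be of bounded fluctuation, with associated numbers $l_2,\ldots,l_a\ge0$; put $l_1=1-\sum_{i=2}^a l_i$ and $c=\sum_{i=1}^a l_i\log|z_i|$. Assume that the function $g=f+c$ is strongly regular. Then for every $\rho\in E_A^{\mathbb{N}}$ there exist constants $C,D>0$ such that $$C\le\liminf_{T\to\infty}\frac{N_\rho^\lambda(T)}{e^{\delta^\lambda T}}\le\limsup_{T\to\infty}\frac{N_\rho^\lambda(T)}{e^{\delta^\lambda T}}\le D.$$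
   Context: Symbolic space. $E$ is a countable (finite or infinite) alphabet and $A:E\times E\to\{0,1\}$ an incidence matrix. $E_A^{\mathbb{N}}$ is the set of admissible sequences $\rho=\rho_1\rho_2\ldots$ ($A(\rho_i,\rho_{i+1})=1$ for all $i$); $E_A^n$ is the set of admissible words of length $n$; $E_A^*=\bigcup_{n\ge1}E_A^n$; $|\omega|$ is the length of $\omega$. For $\rho\in E_A^{\mathbb{N}}$, $E_\rho^*$ (resp. $E_\rho^n$) is the set of $\omega\in E_A^*$ (resp. $E_A^n$) with $\omega\rho$ admissible. $[\omega]$ is the cylinder of sequences in $E_A^{\mathbb{N}}$ beginning with $\omega$; $\sigma$ is the left shift. $A$ is finitely irreducible if there is a finite set $\Omega$ of words such that for all $e,e'\in E$ some $\omega\in\Omega$ makes $e\omega e'$ admissible. CIFS. $X\subset\mathbb{R}^d$ is compact and connected with $X=\overline{\mathrm{Int}(X)}$ ($\mathbb{R}^2$ identified with $\mathbb{C}$). A CIFS is a family of injective contractions $\phi_e:X\to X$ ($e\in E$) with Lipschitz constants at most some $\kappa\in(0,1)$ such that: $\phi_e(\mathrm{Int}X)\cap\phi_{e'}(\mathrm{Int}X)=\emptyset$ for $e\ne e'$; there is an open connected $W\supset X$ such that each $\phi_e$ extends to a $C^1$ conformal diffeomorphism from $W$ into $W$ with Lipschitz constant at most $\kappa$; there are $L\ge1$, $\alpha>0$ with $\bigl||\phi_e'(s)|/|\phi_e'(t)|-1\bigr|\le L\|s-t\|^\alpha$ for all $e\in E$, $s,t\in X$, where $|\phi_e'(t)|$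 is the scaling factor of the derivative. For $\rho\in E_A^{\mathbb{N}}$, $\pi(\rho)$ is the unique point of $\bigcap_{n\ge1}\phi_{\rho_1}\circ\cdots\circ\phi_{\rho_n}(X)$. The deterministic potential is $f(\rho)=\log|\phi_{\rho_1}'(\pi(\sigma\rho))|$. For a function $h$ on $E_A^{\mathbb{N}}$, $S_nh(\rho)=\sum_{i=0}^{n-1}h(\sigma^i\rho)$. Random CIFS. $\mathcal{Z}\subset\{z\in\mathbb{C}:\epsilon<|z|\le1\}$ for some $\epsilon>0$ (real numbers if $d=1$). $\Lambda=\mathcal{Z}^{\mathbb{Z}}$ carries a Bernoulli probability measure $\nu$ and the left shift. One sets $\phi_e^\lambda=\lambda_0\phi_e$ and it is assumed that for $\nu$-a.e. $\lambda$ the maps $\phi_e^\lambda$ again map $X$ into $X$ and satisfy the conditions listed above (with the same constants for a.e. $\lambda$). The random potential is $f(\rho,\lambda)=f(\rho)+\log|\lambda_0|$, with random ergodic sum $$S_nf(\rho,\lambda)=S_nf(\rho)+\log|\lambda_0\lambda_1\cdots\lambda_{n-1}|.$$ Pressure. For a real function $h$ on $E_A^{\mathbb{N}}$, $P(xh)=\lim_n\frac1n\log\sum_{\omega\in E_A^n}\exp(x\sup_{[\omega]}S_nh)$, $x\in\mathbb{R}$. $h$ is strongly regular if $P(xh)=0$ for some $x>0$ and $0<P(xh)<\infty$ for some $x>0$. Counting. For $\rho\in E_A^{\mathbb{N}}$, $\lambda\in\Lambda$, $T>0$, $N_\rho^\lambda(T)=\#\{\omega\in E_\rho^*:S_{|\omega|}f(\omega\rho,\lambda)\ge-T\}$.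 The random Poincaré series is $\eta_\rho^\lambda(s)=\int_0^\infty e^{-sT}\,dN_\rho^\lambda(T)=\sum_{n\ge1}\sum_{\omega\in E_\rho^n}\exp(sS_nf(\omega\rho,\lambda))$, and $\delta^\lambda$ is its abscissa of convergence (its critical line of convergence is $\mathrm{Re}\,s=\delta^\lambda$). Bounded fluctuation. For $n\ge1$, $z\in\mathcal{Z}$, let $s_{n,z}(\lambda)$ be the number of times $z$ appears in $\lambda_0\lambda_1\ldots\lambda_{n-1}$. $\lambda\in\Lambda$ is of bounded fluctuation if there are $p,q\in\mathbb{R}$ and real numbers $l_2,\ldots,l_a\ge0$ such that $nl_i+p\le s_{n,z_i}(\lambda)\le nl_i+q$ for all $2\le i\le a$ and all $n\in\mathbb{N}$. *)

(* Defs.v *)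
From HB Require Import structures.
From mathcomp Require Import all_boot all_order all_algebra.
From mathcomp Require Import all_classical all_reals all_analysis.
From mathcomp Require Import complex.

Set Implicit Arguments.
Unset Strict Implicit.
Unset Printing Implicit Defensive.

Import Order.TTheory GRing.Theory Num.Theory.
Import numFieldNormedType.Exports.

Local Open Scope classical_set_scope.
Local Open Scope ring_scope.

Section Symbolic.
Variables (E : countType) (A : rel E).

(* Infinite sequences are indexed from 0, so [rho n] is rho_{n+1}. *)
Definition seqs : set (nat -> E) := [set rho | forall i, A (rho i) (rho i.+1)].

Definition words : set (seq E) := [set w | w != [::] /\ sorted A w].

Definition nwords (n : nat) : set (seq E) := words `&` [set w | size w = n].

Definition cat_seq (w : seq E) (rho : nat -> E) : nat -> E :=
  fun n => if (n < size w)%N then nth (rho 0%N) w n else rho (n - size w)%N.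

Definition words_before (rho : nat -> E) : set (seq E) :=
  words `&` [set w | seqs (cat_seq w rho)].

Definition nwords_before (n : nat) (rho : nat -> E) : set (seq E) :=
  nwords n `&` [set w | seqs (cat_seq w rho)].

Definition cylinder (w : seq E) : set (nat -> E) :=
  seqs `&` [set rho | forall i, (i < size w)%N -> rho i = nth (rho 0%N) w i].

Definition left_shift (rho : nat -> E) : nat -> E := fun n => rho n.+1.

Definition finitely_irreducible : Prop :=
  exists Omega : seq (seq E), {in Omega, forall w, words w} /\
    forall e e', exists2 w, w \in Omega & words (e :: rcons w e').

End Symbolic.

Section Pressure.
Variables (R : realType) (E : countType) (A : rel E).
Implicit Types h : (nat -> E) -> R.

Definition birkhoff h (n : nat) (rho : nat -> E) : R :=
  \sum_(i < n) h (iter i (@left_shift E) rho).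

Local Open Scope ereal_scope.

Definition partition_sum h (x : R) (n : nat) : \bar R :=
  \esum_(w in nwords A n)
    expeR (x%:E * ereal_sup [set (birkhoff h n rho)%:E | rho in cylinder A w]).

(* [pressure_is h x p] is P(xh) = p, including existence of the limit. *)
Definition pressure_is h (x : R) (p : \bar R) : Prop :=
  (fun n : nat => (n%:R^-1)%:E * lne (partition_sum h x n)) @ \oo --> p.

Definition strongly_regular h : Prop :=
  (exists x : R, (0 < x)%R /\ pressure_is h x 0) /\
  (exists (x : R) (p : \bar R),
     [/\ (0 < x)%R, pressure_is h x p, 0 < p & p < +oo]).

End Pressure.

Section Geometry.
Variables (R : realType) (d : nat).
Local Notation V := 'rV[R]_d.
Implicit Types (X W : set V) (f : V -> V).

(* The library norm on 'rV[R]_d is the sup norm. *)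
Definition enorm (v : V) : R := Num.sqrt (\sum_(j < d) v 0 j ^+ 2).

(* For d = 2, [x *m rot90] is i * x under (x_0, x_1) <-> x_0 + i x_1; for
   d = 1 it is 0, so that below only the real part of z acts. *)
Definition rot90 : 'M[R]_d :=
  \matrix_(i, j) (((i == 0 :> nat) && (j == 1 :> nat))%:R
                  - ((i == 1 :> nat) && (j == 0 :> nat))%:R).

Definition complex_scale (z : R[i]) (x : V) : V :=
  complex.Re z *: x + complex.Im z *: (x *m rot90).

Definition lipschitz_at_most X (k : R) f : Prop :=
  forall x y, X x -> X y -> enorm (f x - f y) <= k * enorm (x - y).

Definition C1_on W f : Prop :=
  forall x, W x -> differentiable f x /\ {for x, continuous (jacobian f)}.

Definition C1_diffeo_onto_image W f : Prop :=
  [/\ C1_on W f, open (f @` W) &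
      exists g, (forall x, W x -> g (f x) = x) /\ C1_on (f @` W) g].

Definition is_scaling f (r : R) : Prop :=
  0 < r /\ forall v, enorm (f v) = r * enorm v.

Definition conformal_on W f : Prop :=
  forall x, W x -> exists r, is_scaling ('d f x) r.

(* |f'(x)|; unique for d > 0 whenever the derivative is a similarity. *)
Definition scaling_factor (f : V -> V) (x : V) : R := xget 0 (is_scaling ('d f x)).

End Geometry.

Section CIFS.
Variables (R : realType) (d : nat) (E : countType).
Local Notation V := 'rV[R]_d.

(* [phi e] stands both for the contraction on X and for its conformal
   extension to W; values outside W are irrelevant. *)
Record is_CIFS (X : set V) (phi : E -> V -> V) (kappa L alpha : R) : Prop := {
  cifs_nonempty : X !=set0 ;
  cifs_compact : compact X ;
  cifs_connected : connected X ;
  cifs_regular : X = closure (interior X) ;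
  cifs_kappa : 0 < kappa < 1 ;
  cifs_L : 1 <= L ;
  cifs_alpha : 0 < alpha ;
  cifs_maps : forall e x, X x -> X (phi e x) ;
  cifs_inj : forall e x y, X x -> X y -> phi e x = phi e y -> x = y ;
  cifs_contract : forall e, lipschitz_at_most X kappa (phi e) ;
  cifs_osc : forall e e', e <> e' ->
    phi e @` interior X `&` phi e' @` interior X = set0 ;
  cifs_ext : exists W : set V,
    [/\ open W, connected W, X `<=` W &
        forall e, [/\ forall x, W x -> W (phi e x),
                      C1_diffeo_onto_image W (phi e),
                      conformal_on W (phi e) &
                      lipschitz_at_most W kappa (phi e)]] ;
  cifs_distortion : forall e s t, X s -> X t ->
    `| scaling_factor (phi e) s / scaling_factor (phi e) t - 1 |
      <= L * enorm (s - t) `^ alpha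
}.

Variables (X : set V) (phi : E -> V -> V).

Fixpoint compose_along (n : nat) (rho : nat -> E) : V -> V :=
  if n is m.+1 then phi (rho 0%N) \o compose_along m (left_shift rho) else id.

Definition coding (rho : nat -> E) : V :=
  xget 0 (\bigcap_(n in [set n | (0 < n)%N]) (compose_along n rho @` X)).

Definition potential (rho : nat -> E) : R :=
  ln (scaling_factor (phi (rho 0%N)) (coding (left_shift rho))).

End CIFS.

HB.instance Definition _ n := isPointed.Build 'I_n.+1 ord0.

Section Random.
Variables (R : realType) (a : nat).

(* A finite set Z = {z_1, ..., z_{a+1}} is given by an injective
   z : 'I_a.+1 -> R[i] (with z ord0 = z_1), and Z^Z by sequences of indices;
   [fun k => z (lambda k)] is the corresponding sequence of complex numbers. *)
Definition coordinate_sets : set (set (int -> 'I_a.+1)) :=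
  [set B | exists (k : int) (i : 'I_a.+1), B = [set lambda | lambda k = i]].

Definition Lambda := g_sigma_algebraType coordinate_sets.

Definition bernoulli_measure (nu : probability Lambda R) : Prop :=
  exists p : 'I_a.+1 -> R,
    [/\ forall i, 0 <= p i, \sum_i p i = 1 &
        forall (J : seq int) (w : int -> 'I_a.+1), uniq J ->
          nu [set lambda : int -> 'I_a.+1 | {in J, forall k, lambda k = w k}]
          = (\prod_(k <- J) p (w k))%:E].

Definition cmod (z : R[i]) : R := ComplexField.Normc.normc z.

Definition alphabet_ok (d : nat) (z : 'I_a.+1 -> R[i]) : Prop :=
  [/\ injective z,
      exists2 eps : R, 0 < eps & forall i, eps < cmod (z i) <= 1 &
      d = 1%N -> forall i, complex.Im (z i) = 0].

Definition occurrences (i : 'I_a.+1) (n : nat) (lambda : int -> 'I_a.+1) : nat :=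
  (\sum_(k < n) (lambda (k : nat)%:Z == i))%N.

(* [l j] is l_{j+2}, attached to the letter z_{j+2} = z (lift ord0 j). *)
Definition bounded_fluctuation (lambda : int -> 'I_a.+1) (l : 'I_a -> R) : Prop :=
  (forall j, 0 <= l j) /\
  exists p q : R, forall (j : 'I_a) (n : nat), (0 < n)%N ->
    n%:R * l j + p <= (occurrences (lift ord0 j) n lambda)%:R <= n%:R * l j + q.

Definition mean_log (z : 'I_a.+1 -> R[i]) (l : 'I_a -> R) : R :=
  (1 - \sum_j l j) * ln (cmod (z ord0))
  + \sum_j l j * ln (cmod (z (lift ord0 j))).

Section Counting.
Variables (E : countType) (A : rel E) (f : (nat -> E) -> R).
Variables (z : 'I_a.+1 -> R[i]) (lambda : int -> 'I_a.+1).

Definition random_birkhoff (n : nat) (rho : nat -> E) : R :=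
  birkhoff f n rho + ln (cmod (\prod_(k < n) z (lambda (k : nat)%:Z))).

Definition count_words (rho : nat -> E) (T : R) : \bar R :=
  counting [set w | words_before A rho w /\
                    - T <= random_birkhoff (size w) (cat_seq w rho)].

Local Open Scope ereal_scope.

Definition poincare (rho : nat -> E) (s : R) : \bar R :=
  \sum_(1 <= n <oo) \esum_(w in nwords_before A n rho)
     (expR (s * random_birkhoff n (cat_seq w rho)))%:E.

(* The terms are positive, so the half-plane of convergence is determined by
   real s; the value is kept in \bar R and may a priori be infinite. *)
Definition abscissa (rho : nat -> E) : \bar R :=
  ereal_inf [set s%:E | s in [set s : R | poincare rho s < +oo]].

End Counting.

End Random.

(* Main.v *)
(** Bounded fluctuation makes the random Birkhoff sum of every word differ from
    that of [g = f + c] by a bounded amount, so it suffices to count words for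
    [g].  Let [G w] be the supremum of the Birkhoff sum of [g] over the cylinder
    of [w]; up to a bounded error [G] is additive under concatenation, and
    [G w <= - b |w|].  If [P (del g) = 0], finite irreducibility makes the
    partition sums [Z_n] at [del] almost multiplicative, hence [1 <= Z_n <= D].
    With [0 <= s < del] such that [P (s g)] is finite, the elementary counting
    bounds are as follows.
    - Upper bound: along the prefixes of one long word the values of [G] are
      [b]-separated, so the sum of [exp (s G w)] over [G w >= - T] is at most a
      constant times [exp ((del - s) T)].
    - Lower bound: every long word has a first prefix [w e] with
      [G (w e) < - T <= G w].  As [sum_e exp (s G e)] is finite, [Z_n >= 1] forces
      the same sum at [s] to be at least a constant times [exp ((del - s) T)]; by
      the upper bound its part over [G w >= - (T - B)] is negligible for large
      [B], and every other term is at most [exp (s (B - T))].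
    Words are finally closed up to end before [rho] by a bounded linking word. *)
Require Import Defs.
From HB Require Import structures.
From mathcomp Require Import all_boot all_order all_algebra.
From mathcomp Require Import all_classical all_reals all_analysis.
From mathcomp Require Import complex finmap.
From mathcomp Require Import ring lra.

Import Order.TTheory GRing.Theory Num.Theory.
Import numFieldNormedType.Exports.

Local Open Scope classical_set_scope.
Local Open Scope ring_scope.

Set Implicit Arguments.
Unset Strict Implicit.
Unset Printing Implicit Defensive.

(** * Sums over words *)

Section WordSums.
Context {R : realType} {E : countType}.
Implicit Types (F H : seq E -> \bar R) (n m : nat).
Local Open Scope ereal_scope.

Lemma esumZl (T : choiceType) (S : set T) (r : R) (a : T -> \bar R) :
  (0 <= r)%R -> (forall i, 0 <= a i) ->
  \esum_(i in S) (r%:E * a i) = r%:E * \esum_(i in S) a i.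
Proof.
move=> r0 a0; rewrite /esum -ereal_supZl//; last first.
  by apply/set0P; exists 0; exists set0; rewrite ?fsbig_set0//; split.
rewrite image_comp; congr ereal_sup; apply: eq_imagel => B _ /=.
by rewrite ge0_mule_fsumr.
Qed.

Lemma counting_esum (T : choiceType) (S : set T) :
  counting S = \esum_(x in S) (1 : \bar R).
Proof.
rewrite /counting; case: asboolP => [fS|iS].
  rewrite esum_fset// (eq_fsbigr (cst 1))// fsbig_finite//=.
  by rewrite card_fset_sum1 natr_sum -sumEFin.
apply/esym/eqyP => r r0.
have [B BS Br] := infinite_set_fset (Num.truncn r).+1 iS.
apply: esum_ge; exists [set` B] => //.
rewrite (eq_fsbigr (cst 1))// fsbig_finite//= set_fsetK sumEFin.
rewrite -(natr_sum _ _ _ (fun=> 1%N)) -card_fset_sum1 lee_fin.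
by rewrite (le_trans (ltW (truncnS_gt r)))// ler_nat.
Qed.

(** All words of length [n] are summed, admissible or not: concatenation is then a bijection between
    pairs and longer words, and admissibility is left to the vanishing of the summand. *)
Definition wsum n F := \esum_(w in [set w | size w = n]) F w.

Lemma wsum_ge0 n F : (forall w, 0 <= F w) -> 0 <= wsum n F.
Proof. by move=> F0; apply: esum_ge0. Qed.

Lemma le_wsum n F H : (forall w, size w = n -> F w <= H w) ->
  wsum n F <= wsum n H.
Proof. by move=> FH; apply: le_esum. Qed.

Lemma eq_wsum n F H : (forall w, size w = n -> F w = H w) ->
  wsum n F = wsum n H.
Proof. by move=> FH; apply: eq_esum. Qed.

Lemma wsumZ n F (r : R) : (0 <= r)%R -> (forall w, 0 <= F w) ->
  wsum n (fun w => r%:E * F w) = r%:E * wsum n F.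
Proof. exact: esumZl. Qed.

Lemma wsum_le1 F w : (forall w, 0 <= F w) -> F w <= wsum (size w) F.
Proof.
move=> F0; apply: esum_ge; exists [set w]; last by rewrite fsbig_set1.
by split => // _ ->.
Qed.

Lemma wsum0 F : (forall w, 0 <= F w) -> wsum 0 F = F [::].
Proof.
move=> F0; rewrite /wsum (_ : [set _ | _] = [set [::]]) ?esum_set1//.
by apply/seteqP; split => [w /size0nil ->|w ->].
Qed.

Lemma wsum_add n m F : (forall w, 0 <= F w) ->
  wsum (n + m) F = wsum n (fun u => wsum m (fun v => F (u ++ v))).
Proof.
move=> F0; rewrite /wsum esum_esum//.
apply: (reindex_esum _ _ (fun p => p.1 ++ p.2)); split.
- by move=> [u v] /= [un vm]; rewrite size_cat un vm.
- move=> [u v] [u' v'] /set_mem[/= un vm] /set_mem[/= un' vm'] e.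
  have /eqP := e; rewrite eqseq_cat ?un ?un'// => /andP[/eqP -> /eqP ->] //.
- move=> w /= wnm; exists (take n w, drop n w); last by rewrite /= cat_take_drop.
  by split; rewrite /= ?size_takel ?wnm ?leq_addr// size_drop wnm addKn.
Qed.

Lemma wsumD n F H : (forall w, 0 <= F w) -> (forall w, 0 <= H w) ->
  wsum n (fun w => F w + H w) = wsum n F + wsum n H.
Proof. by move=> F0 H0; apply: esumD. Qed.

Lemma wsum_sum n (I : choiceType) (r : seq I) (P : pred I) (F : seq E -> I -> \bar R) :
  (forall w i, 0 <= F w i) ->
  wsum n (fun w => \sum_(i <- r | P i) F w i) = \sum_(i <- r | P i) wsum n (F ^~ i).
Proof. by move=> F0; apply: esum_sum. Qed.

Lemma esum_wsum F : (forall w, 0 <= F w) ->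
  \esum_(w in setT) F w = \sum_(0 <= n <oo) wsum n F.
Proof.
move=> F0; rewrite -nneseries_sum_bigcup//.
  by congr esum; apply/seteqP; split => // w _; exists (size w).
by move=> i j _ _ [w [<- <-]].
Qed.

Lemma sum_wsum_le_esum N F : (forall w, 0 <= F w) ->
  \sum_(n < N) wsum n F <= \esum_(w in setT) F w.
Proof.
move=> F0; rewrite esum_wsum// -(big_mkord xpredT (fun n => wsum n F)).
by apply: nneseries_lim_ge => n _ _; exact: wsum_ge0.
Qed.

Lemma esum_le_wsum F (x : \bar R) : (forall w, 0 <= F w) ->
  (forall N, \sum_(n < N) wsum n F <= x) -> \esum_(w in setT) F w <= x.
Proof.
move=> F0 Fx; rewrite esum_wsum//; apply: lime_le.
  by apply: is_cvg_nneseries => n _ _; exact: wsum_ge0.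
by near=> N; rewrite big_mkord.
Unshelve. all: by end_near. Qed.

(** Appending a fixed [t] is injective, so each [t] in [Om] contributes at most the whole sum of
    [H]. This bounds how often a word arises by linking. *)
Lemma esum_link (Om : seq (seq E)) F H : (forall w, 0 <= F w) ->
  (forall w, 0 <= H w) ->
  (forall u, F u <= \sum_(t <- Om) H (u ++ t)) ->
  \esum_(w in setT) F w <= (size Om)%:R%:E * \esum_(w in setT) H w.
Proof.
move=> F0 H0 FH.
apply: (@le_trans _ _ (\esum_(u in setT) \sum_(t <- Om) H (u ++ t))).
  exact: le_esum.
rewrite esum_sum//.
apply: (@le_trans _ _ (\sum_(t <- Om) \esum_(w in setT) H w)).
  apply: lee_sum => t _.
  have inj : set_inj setT (fun u => u ++ t).
    move=> u v _ _ e; have /addIn uv : (size u + size t = size v + size t)%N.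
      by rewrite -!size_cat e.
    by have /eqP := e; rewrite eqseq_cat// => /andP[/eqP].
  rewrite -(esum_image _ _ H inj) esum_mkcond; apply: le_esum => w _.
  by case: ifP.
have -> : (size Om)%:R%:E = \sum_(t <- Om) (1 : \bar R).
  by rewrite sumEFin big_const_seq count_predT iter_addr_0.
rewrite muleC ge0_sume_distrr//.
by apply: lee_sum => t _; rewrite mule1.
Qed.

End WordSums.

(** * Growth of sequences and geometric sums *)

Section Growth.
Context {R : realType}.

(** Along the multiples of [n] the averages of [y] tend to 0 but are at most [t / n]. With [y] the
    logarithm of the partition sums, this turns zero pressure into a bound for each single [n]. *)
Lemma growth_ge0 (y : nat -> R) n t : (0 < n)%N ->
  (fun k : nat => k%:R^-1 * y k) @ \oo --> (0 : R) ->
  (forall k, (0 < k)%N -> y (n * k)%N <= k%:R * t) -> 0 <= t.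
Proof.
move=> n0 y0 yt.
have n0R : 0 < n%:R :> R by rewrite ltr0n.
suff : 0 <= n%:R^-1 * t by rewrite pmulr_rge0// invr_gt0.
have sub : (fun k : nat => (n * k)%:R^-1 * y (n * k)%N) @ \oo --> (0 : R).
  by apply: (cvg_comp _ _ _ y0); exact: cvg_mulnl.
apply: (ler_cvg_to sub (@cvg_cst _ _ _ _ _)).
near=> k; have k0 : (0 < k)%N by near: k; exact: nbhs_infty_gt.
rewrite natrM invfM -mulrA ler_wpM2l ?invr_ge0 ?ler0n// ler_pdivrMl ?ltr0n//.
exact: yt.
Unshelve. all: by end_near. Qed.

Lemma growth_le0 (y : nat -> R) n t : (0 < n)%N ->
  (fun k : nat => k%:R^-1 * y k) @ \oo --> (0 : R) ->
  (forall k, (0 < k)%N -> k%:R * t <= y (n * k)%N) -> t <= 0.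
Proof.
move=> n0 y0 yt; rewrite -oppr_ge0.
apply: (@growth_ge0 (fun k => - y k) n _ n0) => [|k k0].
  rewrite -oppr0; under eq_fun do rewrite mulrN.
  exact: cvgN.
by rewrite mulrN lerN2 yt.
Qed.

(* Values of the walk are [c]-separated, so the sum is dominated by a geometric series. *)
Lemma separated_sum_le (c th : R) (y : nat -> R) N :
  0 < c -> 0 < th -> (forall n, (n.+1 < N)%N -> y n.+1 <= y n - c) ->
  \sum_(n < N) (if 0 <= y n then expR (- (th * y n)) else 0)
    <= (1 - expR (- (th * c)))^-1.
Proof.
move=> c0 th0.
set r := expR (- (th * c)).
have r0 : 0 < r by exact: expR_gt0.
have r1 : 0 < 1 - r by rewrite subr_gt0 expR_lt1 oppr_lt0 mulr_gt0.
have i0 : 0 < (1 - r)^-1 by rewrite invr_gt0.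
pose S N := \sum_(n < N) (if 0 <= y n then expR (- (th * y n)) else 0).
rewrite -/(S N).
(* The induction carries a second bound, relative to the last term: while the walk is nonnegative,
   the last term dominates the sum. *)
have key M : (M < N)%N -> (forall n, (n.+1 < N)%N -> y n.+1 <= y n - c) ->
    (S M.+1 <= (1 - r)^-1) /\
    (0 <= y M -> S M.+1 <= (1 - r)^-1 * expR (- (th * y M))).
  move=> + hy; elim: M => [|M IH] MN.
    rewrite /S big_ord1; suff h : 0 <= y 0%N ->
      expR (- (th * y 0%N)) <= (1 - r)^-1 * expR (- (th * y 0%N)) /\
      (1 - r)^-1 * expR (- (th * y 0%N)) <= (1 - r)^-1.
      by case: ifP => [/h[h1 h2]|_]; split=> //; [exact: le_trans h2|exact: ltW].
    move=> y0; rewrite ler_peMl ?expR_ge0//; last first.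
      by rewrite invf_ge1// lerBlDr lerDl ltW.
    by rewrite ler_piMr ?(ltW i0)// expR_le1 oppr_le0 mulr_ge0// ltW.
  have {IH} [IH1 IH2] := IH (ltnW MN).
  have yM := hy _ MN.
  rewrite /S big_ord_recr/= -/(S M.+1).
  case: ifP => [yM1|_]; last by rewrite addr0; split.
  have yM0 : 0 <= y M by lra.
  have e1 : expR (- (th * y M)) <= r * expR (- (th * y M.+1)).
    by rewrite -expRD ler_expR; nra.
  have bnd : S M.+1 + expR (- (th * y M.+1)) <= (1 - r)^-1 * expR (- (th * y M.+1)).
    apply: le_trans (lerD (IH2 yM0) (lexx _)) _.
    apply: (@le_trans _ _ ((1 - r)^-1 * (r * expR (- (th * y M.+1))) + expR (- (th * y M.+1)))).
      by rewrite lerD2r ler_wpM2l// ltW.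
    rewrite le_eqVlt; apply/orP; left; apply/eqP; field; lra.
  split => //; apply: le_trans bnd _.
  by rewrite ler_piMr ?(ltW i0)// expR_le1 oppr_le0 mulr_ge0// ltW.
case: N key => [|M] key hy; first by rewrite /S big_ord0 ltW.
by case: (key M (ltnSn _) hy).
Qed.

End Growth.

Lemma geometric_sum_le (R : realType) (q : R) N : 0 <= q < 1 ->
  \sum_(n < N) q ^+ n <= (1 - q)^-1.
Proof.
move=> /andP[q0 q1]; rewrite -[leRHS]mul1r ler_pdivlMr ?subr_gt0//.
rewrite mulrC -[(1 - q)%R]opprB mulNr -subrX1 opprB gerDl oppr_le0.
exact: exprn_ge0.
Qed.

(** * Almost additive potentials on words *)

(** The properties of the supremum of a Birkhoff sum over a cylinder from which all counting is
    derived; [K] comes from bounded distortion and [Om] from finite irreducibility. *)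
Record word_potential {R : realType} {E : countType} (A : rel E)
    (G : seq E -> R) (b K : R) (Om : seq (seq E)) : Prop := {
  wp_b : 0 < b ;
  wp_nil : G [::] = 0 ;
  wp_decay : forall w, sorted A w -> G w <= - (b * (size w)%:R) ;
  wp_sub : forall u v, sorted A (u ++ v) -> G (u ++ v) <= G u + G v ;
  wp_super : forall u v, sorted A (u ++ v) -> G u + G v - K <= G (u ++ v) ;
  wp_link : forall u v, sorted A u -> sorted A v ->
    exists2 t, t \in Om & sorted A (u ++ t ++ v)
}.

(** * Weights of words and almost multiplicativity of partition sums *)

Section Weights.
Context {R : realType} {E : countType} {A : rel E} {G : seq E -> R} {b K : R}.
Context {Om : seq (seq E)}.
Hypothesis wp : word_potential A G b K Om.
Implicit Types (u v w t : seq E) (x s T : R) (n m N : nat).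

Definition weight x w : R := if sorted A w then expR (x * G w) else 0.

Lemma weight_ge0 x w : 0 <= weight x w.
Proof. by rewrite /weight; case: ifP => // _; exact: expR_ge0. Qed.

Lemma weight_nil x : weight x [::] = 1.
Proof. by rewrite /weight/= (wp_nil wp) mulr0 expR0. Qed.

Lemma sorted_catl u v : sorted A (u ++ v) -> sorted A u.
Proof. by case/cat_sorted2. Qed.

Lemma sorted_catr u v : sorted A (u ++ v) -> sorted A v.
Proof. by case/cat_sorted2. Qed.

Lemma G_le0 w : sorted A w -> G w <= 0.
Proof.
move=> Aw; apply: le_trans (wp_decay wp Aw) _.
by rewrite oppr_le0 mulr_ge0// ltW// (wp_b wp).
Qed.

Lemma G_cat_le u v : sorted A (u ++ v) -> G (u ++ v) <= G u - b * (size v)%:R.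
Proof.
move=> Auv; apply: le_trans (wp_sub wp Auv) _.
by rewrite lerD2l (wp_decay wp)// (sorted_catr Auv).
Qed.

Lemma weight_cat x u v : 0 <= x -> weight x (u ++ v) <= weight x u * weight x v.
Proof.
move=> x0; rewrite {1}/weight; case: ifP => Auv; last first.
  by rewrite mulr_ge0 ?weight_ge0.
rewrite /weight (sorted_catl Auv) (sorted_catr Auv) -expRD ler_expR -mulrDr.
by rewrite ler_wpM2l// (wp_sub wp).
Qed.

Lemma weight_anti x s w : x <= s -> weight s w <= weight x w.
Proof.
move=> xs; rewrite /weight; case: ifP => // Aw.
by rewrite ler_expR ler_wnM2r// G_le0.
Qed.

Local Open Scope ereal_scope.

Definition Zsum x n : \bar R := wsum n (fun w => (weight x w)%:E).

Let wt0 x w : 0 <= (weight x w)%:E. Proof. by rewrite lee_fin weight_ge0. Qed.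
Hint Resolve wt0 : core.

Lemma Zsum_ge0 x n : 0 <= Zsum x n. Proof. exact: wsum_ge0. Qed.
Hint Resolve Zsum_ge0 : core.

Lemma Zsum0 x : Zsum x 0 = 1.
Proof. by rewrite /Zsum wsum0// weight_nil. Qed.

Lemma wsum_weight_cat x w m : (0 <= x)%R ->
  wsum m (fun v => (weight x (w ++ v))%:E) <= (weight x w)%:E * Zsum x m.
Proof.
move=> x0; rewrite -wsumZ ?weight_ge0//; apply: le_wsum => v _.
by rewrite -EFinM lee_fin weight_cat.
Qed.

Lemma ZsumD x n m : (0 <= x)%R -> Zsum x m < +oo ->
  Zsum x (n + m) <= Zsum x n * Zsum x m.
Proof.
move=> x0 Zm; have /fineK Zmf : Zsum x m \is a fin_num by rewrite ge0_fin_numE.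
rewrite [leLHS]wsum_add// [leRHS]muleC -Zmf -wsumZ ?fine_ge0//.
by apply: le_wsum => u _; rewrite Zmf muleC; exact: wsum_weight_cat.
Qed.

Lemma Zsum_fin x n : (0 <= x)%R -> Zsum x 1 < +oo -> Zsum x n \is a fin_num.
Proof.
move=> x0 Z1; rewrite ge0_fin_numE//; elim: n => [|n IH].
  by rewrite Zsum0 ltry.
rewrite -addn1; apply: le_lt_trans (ZsumD n x0 Z1) _.
by rewrite lte_mul_pinfty// ge0_fin_numE.
Qed.

Lemma Zsum_expn x n k : (0 <= x)%R -> Zsum x 1 < +oo ->
  Zsum x (n * k) <= Zsum x n ^+ k.
Proof.
move=> x0 Z1; elim: k => [|k IH]; first by rewrite muln0 Zsum0.
rewrite mulnS expeS.
have Zf m : Zsum x m < +oo by rewrite -ge0_fin_numE ?Zsum_fin.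
by apply: le_trans (ZsumD n x0 (Zf _)) _; rewrite lee_pmul.
Qed.

Lemma Zsum_anti x s n : (x <= s)%R -> Zsum s n <= Zsum x n.
Proof. by move=> xs; apply: le_wsum => w _; rewrite lee_fin weight_anti. Qed.

Lemma weight_link x u v : (0 <= x)%R -> sorted A u -> sorted A v ->
  exists2 t, t \in Om & sorted A (u ++ t ++ v) /\
    (weight x v <= expR (x * (K - G t)) * weight x (t ++ v))%R.
Proof.
move=> x0 Au Av; have [t tOm Autv] := wp_link wp Au Av; exists t => //.
split => //; have Atv := sorted_catr Autv.
rewrite /weight Atv Av -expRD ler_expR -mulrDr ler_wpM2l//.
by have := wp_super wp Atv; lra.
Qed.

(** Any [v] can be placed after [w] behind some [t] in [Om], its weight changing by a bounded
    factor. The words [t ++ v] are too long by the length of [t], so their tails of that length are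
    summed out. *)
Lemma Zsum_link x w m : (0 <= x)%R -> Zsum x 1 < +oo -> sorted A w ->
  Zsum x m <= (\sum_(t <- Om) expR (x * (K - G t)) * fine (Zsum x (size t)))%R%:E *
    wsum m (fun v => (if sorted A (w ++ v) then weight x v else 0%R)%:E).
Proof.
move=> x0 Z1 Aw; pose H t := (if sorted A (w ++ t) then weight x t else 0%R)%:E.
have H0 t : 0 <= H t by rewrite /H; case: ifP.
have HcatR u v : H (u ++ v) <= H u * (weight x v)%:E.
  rewrite /H catA; case: ifP => Auv; last by rewrite mule_ge0// -/(H u).
  by rewrite (sorted_catl Auv) -EFinM lee_fin weight_cat.
pose c t := expR (x * (K - G t)).
have c0 t : (0 <= c t)%R by exact: expR_ge0.
have cE0 t : 0 <= (c t)%:E by rewrite lee_fin.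
apply: (@le_trans _ _ (wsum m (fun v => \sum_(t <- Om) (c t)%:E * H (t ++ v)))).
  apply: le_wsum => v _; have [Av|nAv] := boolP (sorted A v); last first.
    rewrite {1}/weight (negbTE nAv); apply: sume_ge0 => t _.
    by rewrite mule_ge0.
  have [t tOm [Atv le_tv]] := weight_link x0 Aw Av.
  rewrite (big_rem t)//= -[leLHS]adde0 leeD//; last first.
    by apply: sume_ge0 => t' _; rewrite mule_ge0.
  by rewrite /H Atv -EFinM lee_fin.
rewrite wsum_sum; last by move=> v t; rewrite mule_ge0.
rewrite -sumEFin ge0_sume_distrl; last first.
  by move=> t _; rewrite lee_fin mulr_ge0// fine_ge0.
apply: lee_sum => t _; rewrite wsumZ// EFinM -muleA lee_wpmul2l//.
have -> : (fine (Zsum x (size t)))%:E = Zsum x (size t) by rewrite fineK// Zsum_fin.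
apply: (@le_trans _ _ (wsum (size t) (fun u => wsum m (fun v => H (u ++ v))))).
  by apply: (wsum_le1 (F := fun u => wsum m (fun v => H (u ++ v)))) => u;
    exact: wsum_ge0.
(* The words of length [size t + m] are cut again, now after their first [m] letters; the remaining
   tail costs the factor [Zsum x (size t)]. *)
rewrite -wsum_add// addnC wsum_add// -[X in X * _]fineK ?Zsum_fin//.
rewrite -wsumZ ?fine_ge0//; apply: le_wsum => v _.
rewrite fineK ?Zsum_fin// muleC [X in X * _](_ : _ = (fine (H v))%:E)//.
by rewrite -wsumZ ?fine_ge0//; exact: le_wsum.
Qed.

(** A converse to submultiplicativity for a fixed prefix [w]: [Zsum_link] restricts to continuations
    compatible with [w], and [wp_super] recombines the weights. *)
Lemma Zsum_super x : (0 <= x)%R -> Zsum x 1 < +oo ->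
  exists2 D : R, (0 < D)%R & forall w m, (weight x w)%:E * Zsum x m <=
    D%:E * wsum m (fun v => (weight x (w ++ v))%:E).
Proof.
move=> x0 Z1.
pose M : R := (\sum_(t <- Om) expR (x * (K - G t)) * fine (Zsum x (size t)))%R.
have M0 : (0 <= M)%R.
  by apply: sumr_ge0 => t _; rewrite mulr_ge0 ?expR_ge0 ?fine_ge0.
(* Adding 1 makes the constant positive even if [M] vanishes. *)
exists ((M + 1) * expR (x * K))%R.
  by rewrite mulr_gt0 ?expR_gt0// ltr_wpDl.
move=> w m; have [Aw|nAw] := boolP (sorted A w); last first.
  rewrite {1}/weight (negbTE nAw) mul0e mule_ge0 ?wsum_ge0// lee_fin.
  by rewrite mulr_ge0 ?expR_ge0// addr_ge0.
apply: (@le_trans _ _ ((weight x w)%:E * (M%:E *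
    wsum m (fun v => (if sorted A (w ++ v) then weight x v else 0%R)%:E)))).
  by rewrite lee_wpmul2l//; exact: Zsum_link.
have H0 v : 0 <= (if sorted A (w ++ v) then weight x v else 0%R)%:E.
  by case: ifP.
apply: (@le_trans _ _ ((M + 1)%:E * ((weight x w)%:E *
    wsum m (fun v => (if sorted A (w ++ v) then weight x v else 0%R)%:E)))).
  rewrite muleCA lee_wpmul2r ?mule_ge0 ?wsum_ge0// lee_fin.
  by rewrite lerDl.
rewrite EFinM -muleA lee_wpmul2l ?lee_fin ?addr_ge0//.
rewrite -!wsumZ ?expR_ge0 ?weight_ge0//; apply: le_wsum => v _.
case: ifP => Awv; last by rewrite mule0 mule_ge0// lee_fin expR_ge0.
rewrite -!EFinM lee_fin /weight Awv Aw (sorted_catr Awv) -!expRD ler_expR.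
by rewrite -!mulrDr ler_wpM2l//; have := wp_super wp Awv; lra.
Qed.

End Weights.

(** * Partition sums at zero pressure *)

Section Counting.
Context {R : realType} {E : countType} {A : rel E} {G : seq E -> R} {b K : R}.
Context {Om : seq (seq E)}.
Hypothesis wp : word_potential A G b K Om.
Implicit Types (u v w t : seq E) (x s T : R) (n m N : nat).
Local Open Scope ereal_scope.

Local Notation wt := (@weight R E A G).
Local Notation Z := (@Zsum R E A G).

Let wt0 x w : 0 <= (wt x w)%:E. Proof. by rewrite lee_fin weight_ge0. Qed.
Hint Resolve wt0 : core.

Lemma Zsum_gt0 x w : sorted A w -> 0 < Z x (size w).
Proof.
move=> Aw; apply: lt_le_trans (wsum_le1 w (wt0 x)).
by rewrite lte_fin /weight Aw expR_gt0.
Qed.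

Lemma Zsum_mul_le x : (0 <= x)%R -> Z x 1 < +oo ->
  exists2 D : R, (0 < D)%R & forall n m, Z x n * Z x m <= D%:E * Z x (n + m).
Proof.
move=> x0 Z1; have [D D0 HD] := Zsum_super wp x0 Z1; exists D => // n m.
have Zm : Z x m \is a fin_num by exact: (Zsum_fin wp).
rewrite {3}/Zsum wsum_add// -wsumZ ?(ltW D0)//; last by move=> u; exact: wsum_ge0.
rewrite [leLHS]muleC -(fineK Zm) -wsumZ ?fine_ge0 ?Zsum_ge0//.
by apply: le_wsum => u _; rewrite fineK// muleC.
Qed.

(** A Fekete-type argument: a partition sum below 1 would decay exponentially along multiples of [n]
    by submultiplicativity, and one above [D] would grow exponentially by the converse inequality;
    zero pressure excludes both. *)
Lemma Zsum_bounds x : (0 <= x)%R -> Z x 1 < +oo ->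
  (forall n, exists2 w, size w = n & sorted A w) ->
  (fun n : nat => (n%:R^-1)%:E * lne (Z x n)) @ \oo --> 0 ->
  exists2 D : R, (0 < D)%R & forall n, 1 <= Z x n <= D%:E.
Proof.
move=> x0 Z1 words Z0; have [D D0 HD] := Zsum_mul_le x0 Z1.
pose zf n := fine (Z x n).
have ZE n : Z x n = (zf n)%:E by rewrite fineK// (Zsum_fin wp).
have zf0 n : (0 < zf n)%R.
  by have [w <- Aw] := words n; rewrite -lte_fin -ZE; exact: Zsum_gt0.
have zD n m : (zf n * zf m <= D * zf (n + m)%N)%R.
  by rewrite -lee_fin !EFinM -!ZE.
have up n k : (zf (n * k)%N <= zf n ^+ k)%R.
  rewrite -lee_fin -ZE EFin_expe -ZE; exact: (Zsum_expn wp).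
have lo n k : (zf n ^+ k <= D ^+ k * zf (n * k)%N)%R.
  elim: k => [|k IH].
    by rewrite muln0 !expr0 mul1r -lee_fin -ZE (Zsum0 wp).
  rewrite mulnS !exprS; apply: (@le_trans _ _ (D ^+ k * (zf n * zf (n * k)%N))%R).
    by rewrite mulrCA ler_wpM2l// ltW.
  by rewrite (mulrC D) -mulrA ler_wpM2l// exprn_ge0// ltW.
have {}Z0 : (fun k : nat => (k%:R^-1 * ln (zf k))%R) @ \oo --> (0 : R)%R.
  move: Z0; under eq_fun do rewrite ZE lne_EFin// -EFinM.
  by move=> /fine_cvg.
(* The added 1 covers [n = 0], where the partition sum equals 1. *)
exists (D + 1)%R; first by rewrite addr_gt0.
case=> [|n].
  by rewrite (Zsum0 wp) lexx/= lee_fin lerDr ltW.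
rewrite ZE !lee_fin; apply/andP; split.
  suff : (0 <= ln (zf n.+1))%R by rewrite -ln1 ler_ln ?posrE.
  apply: (growth_ge0 (n := n.+1) _ Z0) => // k k0.
  by rewrite mulr_natl -lnXn// ler_ln// ?posrE ?exprn_gt0.
suff : (ln (zf n.+1) - ln D <= 0)%R.
  by rewrite subr_le0 ler_ln ?posrE// => /le_trans; apply; rewrite lerDl.
apply: (growth_le0 (n := n.+1) _ Z0) => // k k0.
rewrite mulrBr lerBlDl !mulr_natl -!lnXn// -lnM ?posrE ?exprn_gt0//.
by rewrite ler_ln ?posrE ?mulr_gt0 ?exprn_gt0.
Qed.

End Counting.

(** * Sums over the words above a level *)

Section LevelSums.
Context {R : realType} {E : countType} {A : rel E} {G : seq E -> R} {b K : R}.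
Context {Om : seq (seq E)}.
Hypothesis wp : word_potential A G b K Om.
Implicit Types (u v w t : seq E) (x s T : R) (n m N : nat).
Local Open Scope ereal_scope.

Local Notation wt := (@weight R E A G).
Local Notation Z := (@Zsum R E A G).

Let wt0 x w : 0 <= (wt x w)%:E. Proof. by rewrite lee_fin weight_ge0. Qed.
Hint Resolve wt0 : core.

(** At [x = 0] this is the indicator of the admissible words with [- T <= G w], so [level_sum 0]
    counts words. *)
Definition level x T w : R :=
  if sorted A w && (- T <= G w)%R then expR (x * G w)%R else 0%R.

Lemma level_ge0 x T w : (0 <= level x T w)%R.
Proof. by rewrite /level; case: ifP => // _; exact: expR_ge0. Qed.

Definition level_sum x T N : \bar R :=
  \sum_(n < N) wsum n (fun w => (level x T w)%:E).

Variables (del : R).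
Hypothesis del0 : (0 < del)%R.
Hypothesis Z1 : Z del 1 < +oo.
Variable D : R.
Hypothesis ZD : forall n, 1 <= Z del n <= D%:E.

Let D0 : (0 < D)%R.
Proof.
by have /andP[h1 h2] := ZD 0; rewrite -lte_fin (lt_le_trans lte01)// (le_trans h1).
Qed.

Lemma level_sum_le s : (s < del)%R -> exists2 C : R, (0 < C)%R &
  forall T N, level_sum s T N <= (C * expR ((del - s) * T))%:E.
Proof.
move=> sdel; have [B B0 HB] := Zsum_super wp (ltW del0) Z1.
set th := (del - s)%R; have th0 : (0 < th)%R by rewrite subr_gt0.
pose q := ((1 - expR (- (th * b)))^-1)%R.
have q0 : (0 < q)%R.
  by rewrite invr_gt0 subr_gt0 expR_lt1 oppr_lt0 mulr_gt0// (wp_b wp).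
exists (B * (q * D))%R; first by rewrite !mulr_gt0.
move=> T N.
(* Up to the factor [expR (th * T)], [f] is the density of the level weight at [s] with respect to
   the weight at [del]; it decays with the height of [G w] above [- T]. *)
pose f w := (if 0 <= T + G w then expR (- (th * (T + G w))) else 0)%R.
have f0 w : (0 <= f w)%R by rewrite /f; case: ifP => // _; exact: expR_ge0.
have levelE w : level s T w = (expR (th * T) * (f w * wt del w))%R.
  rewrite /level /f /weight -subr_ge0 opprK addrC.
  case: (sorted A w) => /=; last by rewrite !mulr0.
  case: ifP => _; last by rewrite mul0r mulr0.
  by rewrite -!expRD; congr expR; rewrite /th; ring.
have fw0 u w : 0 <= (f u * wt del w)%:E.
  by rewrite lee_fin; exact: mulr_ge0 (f0 u) (weight_ge0 del w).
(* As the partition sums at [del] are at least 1, a word may be replaced by its extensions at the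
   cost of [B]. This brings all lengths to the common length [N]. *)
have step n m : wsum n (fun w => (f w * wt del w)%:E) <=
    B%:E * wsum (n + m) (fun v => (f (take n v) * wt del v)%:E).
  rewrite wsum_add//.
  rewrite -wsumZ ?(ltW B0)//; last by move=> u; exact: wsum_ge0.
  apply: le_wsum => u un.
  rewrite (eq_wsum (H := fun v => (f u)%:E * (wt del (u ++ v))%:E)); last first.
    by move=> v _; rewrite -un take_size_cat// EFinM.
  rewrite wsumZ// EFinM muleCA lee_wpmul2l ?lee_fin//.
  apply: le_trans (HB u m); rewrite lee_pemulr//.
  by have /andP[] := ZD m.
rewrite /level_sum (eq_bigr (fun n : 'I_N => (expR (th * T))%:E *
    wsum n (fun w => (f w * wt del w)%:E))); last first.
  move=> n _; rewrite -wsumZ ?expR_ge0//; apply: eq_wsum => w _.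
  by rewrite levelE EFinM.
rewrite -ge0_sume_distrr; last by move=> n _; exact: wsum_ge0.
rewrite [(B * _ * _)%R]mulrC EFinM lee_wpmul2l ?lee_fin ?expR_ge0//.
apply: (@le_trans _ _ (\sum_(n < N)
    B%:E * wsum N (fun v => (f (take n v) * wt del v)%:E))).
  by apply: lee_sum => n _; have := step n (N - n)%N; rewrite subnKC// ltnW.
rewrite -ge0_sume_distrr; last by move=> n _; exact: wsum_ge0.
rewrite EFinM lee_wpmul2l ?lee_fin ?(ltW B0)//.
rewrite -(wsum_sum _ _ xpredT (F := fun v (n : 'I_N) => (f (take n v) * wt del v)%:E))//.
apply: (@le_trans _ _ (q%:E * Z del N)); last first.
  by rewrite EFinM lee_wpmul2l ?lee_fin ?(ltW q0)//; have /andP[] := ZD N.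
rewrite -wsumZ ?(ltW q0)//; apply: le_wsum => v vN.
rewrite sumEFin -EFinM lee_fin -mulr_suml.
have [Av|nAv] := boolP (sorted A v); last first.
  by rewrite /weight (negbTE nAv) !mulr0.
rewrite ler_wpM2r ?weight_ge0//.
(* Heights along the prefixes of one word drop by at least [b] per letter, so the sum over prefixes
   is at most [q], uniformly in [T] and [N]. *)
rewrite /f; pose y n := (T + G (take n v))%R.
apply: (separated_sum_le (y := y) (wp_b wp) th0); rewrite /y.
move=> n nN; rewrite -addrA lerD2l.
have nv : (n < size v)%N by rewrite vN ltnW.
have As : sorted A (take n.+1 v).
  by apply: (@sorted_catl _ _ _ (drop n.+1 v)); rewrite cat_take_drop.
have [x0 _] : exists x0 : E, True by case: (v) nv => // x0; exists x0.
move: As; rewrite (take_nth x0 nv) -cats1 => As.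
by have := G_cat_le wp As; rewrite mulr1.
Qed.

(** The shortest prefix below [- T] is not empty, because [G [::] = 0], so its last letter can be
    removed. *)
Lemma crossing_exists T v : (0 <= T)%R -> (G v < - T)%R -> exists2 n, (n < size v)%N &
  (- T <= G (take n v))%R && (G (take n.+1 v) < - T)%R.
Proof.
move=> T0 GvT.
have : exists n, (G (take n v) < - T)%R by exists (size v); rewrite take_size.
move=> /(@ex_minnP (fun n => (G (take n v) < - T)%R))[[|n] Gn minn].
  by move: Gn; rewrite take0 (wp_nil wp) ltNge oppr_le0 T0.
exists n; last by rewrite Gn andbT leNgt; apply/negP => /minn; rewrite ltnn.
by rewrite ltnNge; apply/negP => vn; move: (minn (size v)); rewrite take_size GvT ltnNge vn => /(_ isT).
Qed.

Lemma level_sum_ge s : (0 <= s < del)%R -> Z s 1 < +oo ->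
  exists2 C : R, (0 < C)%R &
  forall T, (0 <= T)%R -> exists N,
    (expR ((del - s) * T))%:E <= C%:E * level_sum s T N.
Proof.
move=> /andP[s0 sdel] Zs1.
have Zs1f : Z s 1 \is a fin_num by rewrite ge0_fin_numE// Zsum_ge0.
set th := (del - s)%R; have th0 : (0 < th)%R by rewrite subr_gt0.
pose z1 := fine (Z s 1).
have z10 : (0 <= z1)%R by rewrite fine_ge0// Zsum_ge0.
exists ((z1 + 1) * D)%R; first by rewrite mulr_gt0// ltr_wpDl.
(* Long enough that [wp_decay] puts every admissible word of length [N] below [- T]. *)
move=> T T0; pose N := (Num.truncn (T / b)).+1.
have TN : (T < b * N%:R)%R.
  by rewrite mulrC -ltr_pdivrMr ?(wp_b wp)// truncnS_gt.
exists N.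
(* The weight of [v], kept only if the letter of index [n] takes it below [- T]. *)
pose cr n v := (if (- T <= G (take n v)) && (G (take n.+1 v) < - T)
  then wt del v else 0)%R.
have cr0 n v : 0 <= (cr n v)%:E by rewrite /cr; case: ifP.
have L0 w : 0 <= (level s T w)%:E by rewrite lee_fin level_ge0.
(* Below [- T] the factor [expR (th * G)] is at most [expR (- (th * T))], so the crossing prefix can
   be weighed at [s], while the tail keeps the exponent [del]. *)
have crE u e v : size e = 1%N -> (cr (size u) (u ++ e ++ v) <=
    expR (- (th * T)) * (level s T u * (wt s e * wt del v)))%R.
  move=> e1; rewrite /cr take_size_cat// -addn1 -e1 catA -size_cat take_size_cat//.
  have rhs0 : (0 <= expR (- (th * T)) * (level s T u * (wt s e * wt del v)))%R.
    by rewrite mulr_ge0 ?expR_ge0// mulr_ge0 ?level_ge0// mulr_ge0 ?weight_ge0.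
  case: ifP => // /andP[Gu Gue].
  have [Auev|nA] := boolP (sorted A ((u ++ e) ++ v)); last first.
    by rewrite {1}/weight (negbTE nA).
  have Aue := sorted_catl Auev; have Au := sorted_catl Aue.
  apply: (le_trans (weight_cat wp _ _ (ltW del0))).
  rewrite mulrA mulrA ler_wpM2r ?weight_ge0// -mulrA.
  apply: (@le_trans _ _ (expR (- (th * T)) * wt s (u ++ e))%R); last first.
    rewrite ler_wpM2l ?expR_ge0//; apply: (le_trans (weight_cat wp _ _ s0)).
    by rewrite /level /weight Au Gu.
  rewrite /weight Aue -expRD ler_expR.
  have -> : del = (th + s)%R by rewrite /th subrK.
  by rewrite mulrDl lerD2r -mulrN ler_wpM2l ?(ltW th0)// ltW.
(* Summing out the tail costs [D] and summing out the crossing letter costs [z1]; only the prefix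
   above [- T] remains. *)
have bnd n m : wsum (n + (1 + m)) (fun v => (cr n v)%:E) <=
    (expR (- (th * T)) * (z1 * D))%:E * wsum n (fun w => (level s T w)%:E).
  rewrite wsum_add// -wsumZ//; last first.
    by rewrite mulr_ge0 ?expR_ge0// mulr_ge0 ?(ltW D0).
  apply: le_wsum => u un; rewrite wsum_add//.
  apply: (@le_trans _ _ (wsum 1 (fun e =>
      (expR (- (th * T)) * level s T u * D)%:E * (wt s e)%:E))); last first.
    rewrite wsumZ//; last by rewrite mulr_ge0 ?(ltW D0)// mulr_ge0 ?expR_ge0// level_ge0.
    rewrite -/(Z s 1) -(fineK Zs1f) -/z1 -!EFinM lee_fin.
    by rewrite le_eqVlt; apply/orP; left; apply/eqP; ring.
  apply: le_wsum => e e1.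
  apply: (@le_trans _ _ (wsum m (fun v =>
      (expR (- (th * T)) * level s T u * wt s e)%:E * (wt del v)%:E))).
    apply: le_wsum => v _; rewrite -EFinM lee_fin -un.
    by apply: le_trans (crE u e v e1) _; rewrite !mulrA.
  have c0 : (0 <= expR (- (th * T)) * level s T u * wt s e)%R.
    by rewrite mulr_ge0 ?weight_ge0// mulr_ge0 ?expR_ge0// level_ge0.
  rewrite wsumZ//.
  apply: (@le_trans _ _ ((expR (- (th * T)) * level s T u * wt s e)%:E * D%:E)).
    by rewrite lee_wpmul2l ?lee_fin//; have /andP[] := ZD m.
  by rewrite -!EFinM lee_fin mulrAC.
have ZN : Z del N <= (expR (- (th * T)) * (z1 * D))%:E * level_sum s T N.
  apply: (@le_trans _ _ (wsum N (fun v => \sum_(n < N) (cr n v)%:E))).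
    apply: le_wsum => v vN.
    have [Av|nA] := boolP (sorted A v); last first.
      by rewrite /weight (negbTE nA) sume_ge0.
    have GvT : (G v < - T)%R.
      by apply: le_lt_trans (wp_decay wp Av) _; rewrite ltrN2 vN.
    have [n nv ncr] := crossing_exists T0 GvT; rewrite vN in nv.
    have crv : cr n v = wt del v by rewrite /cr ncr.
    by rewrite (bigD1 (Ordinal nv))//= crv leeDl// sume_ge0.
  rewrite wsum_sum// /level_sum ge0_sume_distrr; last first.
    by move=> n _; exact: wsum_ge0.
  apply: lee_sum => n _; have := bnd n (N - n.+1)%N.
  by rewrite add1n addnS -addSn subnKC.
have /andP[Z1N _] := ZD N.
have LS0 : 0 <= level_sum s T N by apply: sume_ge0 => n _; exact: wsum_ge0.
rewrite -[leLHS]mule1; apply: (@le_trans _ _ ((expR (th * T))%:E *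
    ((expR (- (th * T)) * (z1 * D))%:E * level_sum s T N))).
  by rewrite lee_wpmul2l ?lee_fin ?expR_ge0//; exact: le_trans ZN.
rewrite muleA -EFinM [(expR _ * (expR _ * _))%R]mulrA -expRD addrN expR0 mul1r lee_wpmul2r// lee_fin.
by rewrite ler_wpM2r ?(ltW D0)// lerDl.
Qed.

Lemma level_count_ge s : (0 <= s < del)%R -> Z s 1 < +oo ->
  exists2 C : R, (0 < C)%R &
  forall T, (0 <= T)%R -> exists N, (C * expR (del * T))%:E <= level_sum 0 T N.
Proof.
move=> sdel Zs1; have /andP[s0 sltd] := sdel.
have [C C0 HC] := level_sum_ge sdel Zs1.
have [C' C'0 HC'] := level_sum_le sltd.
have [C2 C20 HC2] := level_sum_le del0.
set th := (del - s)%R in HC HC'; have th0 : (0 < th)%R by rewrite subr_gt0.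
(* Chosen so that the words above [- (T - B)] account for at most half of the lower bound. *)
pose B := (ln (2 * C * C') / th)%R.
have eB : (expR (- (th * B)) = (2 * C * C')^-1)%R.
  by rewrite /B mulrC divfK ?gt_eqF// expRN lnK// posrE !mulr_gt0.
exists ((2 * C)^-1 * expR (- (s * B)))%R.
  by rewrite mulr_gt0 ?expR_gt0// invr_gt0 mulr_gt0.
move=> T T0; have [N HN] := HC T T0; exists N.
have L0 x S w : 0 <= (level x S w)%:E by rewrite lee_fin level_ge0.
have LS0 x S : 0 <= level_sum x S N by apply: sume_ge0 => n _; exact: wsum_ge0.
(* Finiteness, from the upper bound at exponent 0, lets the final estimate be carried out in the
   reals, where terms can be subtracted. *)
have fin0 : level_sum 0 T N \is a fin_num.
  by rewrite ge0_fin_numE// (le_lt_trans (HC2 T N)) ?ltry.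
(* Words in the strip below [B - T] have weight at most [expR (s * (B - T))] at [s], so there the
   sum is controlled by their number. *)
have split_level : level_sum s T N <=
    level_sum s (T - B) N + (expR (s * (B - T)))%:E * level_sum 0 T N.
  rewrite /level_sum ge0_sume_distrr; last by move=> n _; exact: wsum_ge0.
  rewrite -big_split/=; apply: lee_sum => n _.
  rewrite -wsumZ ?expR_ge0// -wsumD//; last first.
    by move=> w; rewrite mule_ge0// lee_fin expR_ge0.
  apply: le_wsum => w _; rewrite -EFinM -EFinD lee_fin /level.
  case: (sorted A w) => /=; last by rewrite mulr0 addr0.
  have e0 : (0 <= expR (s * (B - T)))%R by exact: expR_ge0.
  case: (leP (- T) (G w))%R => GT; last by rewrite mulr0 addr0; case: ifP => _ //; exact: expR_ge0.
  rewrite mul0r expR0 mulr1.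
  case: ifP => [_|/negbT]; first by rewrite lerDl.
  rewrite -ltNge add0r => GTB; rewrite ler_expR ler_wpM2l//.
  by rewrite opprB in GTB; exact: ltW.
have := le_trans HN (lee_wpmul2l (ltW (C0 : 0 < C%:E)) split_level).
have := HC' (T - B)%R N.
move: fin0 => /fineK <-; set L := fine _.
move=> h1 h2.
have : (expR (th * T) <= C * (C' * expR (th * (T - B)) + expR (s * (B - T)) * L))%R.
  rewrite -lee_fin; apply: le_trans h2 _.
  by rewrite [in leRHS]EFinM lee_wpmul2l ?lee_fin ?(ltW C0)// EFinD leeD.
rewrite mulrBr expRD eB => h3.
have h4 : (expR (th * T) / 2 <= C * (expR (s * (B - T)) * L))%R.
  have e : (C * (C' * (expR (th * T) * (2 * C * C')^-1)) = expR (th * T) / 2)%R.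
    by field; rewrite !gt_eqF.
  by rewrite mulrDr e in h3; lra.
rewrite lee_fin.
have -> : (del * T = th * T - s * (B - T) + s * B)%R by rewrite /th; ring.
rewrite 2!expRD (expRN (s * (B - T))) (expRN (s * B)).
have p1 := expR_gt0 (s * (B - T))%R; have p2 := expR_gt0 (s * B)%R.
rewrite (_ : _ * _ = (expR (th * T) / 2) / (C * expR (s * (B - T))))%R; last first.
  by field; rewrite !gt_eqF.
by rewrite ler_pdivrMr ?mulr_gt0// [leRHS]mulrC -mulrA.
Qed.

End LevelSums.

(** * Counting the words that can precede a fixed sequence *)

Section EndWords.
Context {R : realType} {E : countType} {A : rel E} {G : seq E -> R} {b K : R}.
Context {Om : seq (seq E)}.
Hypothesis wp : word_potential A G b K Om.
Variables (B : set (seq E)) (r : seq E -> R) (K1 : R).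
Hypothesis BA : forall w, B w -> sorted A w.
Hypothesis Bl : forall u, sorted A u -> exists2 t, t \in Om & B (u ++ t).
Hypothesis rG : forall w, B w -> `|r w - G w| <= K1.
Implicit Types (u v w t : seq E) (x s T : R) (n m N : nat).
Local Open Scope ereal_scope.

Local Notation wt := (@weight R E A G).
Local Notation Z := (@Zsum R E A G).
Local Notation lev := (@level R E A G).

Variable del : R.
Hypothesis del0 : (0 < del)%R.
Hypothesis Z1 : Z del 1 < +oo.
Variable D : R.
Hypothesis ZD : forall n, 1 <= Z del n <= D%:E.

Let rG_le w : B w -> (r w <= G w + K1)%R.
Proof. by move=> /rG; rewrite ler_norml => /andP[_]; lra. Qed.

Let rG_ge w : B w -> (G w - K1 <= r w)%R.
Proof. by move=> /rG; rewrite ler_norml => /andP[]; lra. Qed.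

(** [M] sums over the whole finite list [Om], so it bounds the loss whichever linking word is
    chosen. *)
Lemma end_link_loss : exists2 M : R, (0 <= M)%R & forall u, sorted A u ->
  exists2 t, t \in Om & B (u ++ t) /\ (G u - M <= r (u ++ t))%R.
Proof.
exists (\sum_(t <- Om) `|K - G t| + `|K1|)%R.
  by rewrite addr_ge0// sumr_ge0.
move=> u Au; have [t tOm But] := Bl Au; exists t => //; split => //.
have le_t : (`|K - G t| <= \sum_(t <- Om) `|K - G t|)%R.
  by rewrite (big_rem t)//= lerDl sumr_ge0.
have := wp_super wp (BA But); have := rG_ge But.
have := ler_norm (K - G t)%R; have := ler_norm K1.
lra.
Qed.

Let lev0 x T w : 0 <= (lev x T w)%:E.
Proof. by rewrite lee_fin level_ge0. Qed.
Hint Resolve lev0 : core.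

(** With [B] the words before [rho] and [r] their random Birkhoff sum, this is [count_words]. *)
Definition end_count T : \bar R := \esum_(w in [set w | B w /\ (- T <= r w)%R]) 1.

Lemma end_count_le : exists2 C : R, (0 < C)%R &
  forall T, end_count T <= (C * expR (del * T))%:E.
Proof.
have [C C0 HC] := level_sum_le wp del0 Z1 ZD del0.
exists (C * expR (del * K1))%R; first by rewrite mulr_gt0 ?expR_gt0.
move=> T; rewrite -mulrA -expRD -mulrDr [(K1 + T)%R]addrC.
apply: (@le_trans _ _ (\esum_(w in setT)
    (lev 0 (T + K1) w)%:E)).
  rewrite /end_count esum_mkcond; apply: le_esum => w _.
  case: ifP => [/set_mem[Bw Tw]|_]//; rewrite /level BA//= mul0r expR0.
  by rewrite ifT//; have := rG_le Bw; lra.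
by apply: esum_le_wsum => // N; have := HC (T + K1)%R N; rewrite subr0.
Qed.

(** Linking turns a word above [- (T - M)] into an end word above [- T], and [esum_link] bounds the
    multiplicity by the size of [Om]. *)
Lemma end_count_ge s : (0 <= s < del)%R -> Z s 1 < +oo ->
  exists2 C : R, (0 < C)%R & exists T0 : R,
  forall T, (T0 <= T)%R -> (C * expR (del * T))%:E <= end_count T.
Proof.
move=> sdel Zs1; have [C C0 HC] := level_count_ge wp del0 Z1 ZD sdel Zs1.
have [M M0 HM] := end_link_loss.
pose k : R := (size Om)%:R.
have k1 : (0 < k + 1)%R by rewrite ltr_wpDl// ler0n.
exists ((k + 1)^-1 * (C * expR (- (del * M))))%R.
  by rewrite mulr_gt0 ?invr_gt0// mulr_gt0 ?expR_gt0.
(* The threshold makes [T - M] nonnegative, as [level_count_ge] requires. *)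
exists M => T MT.
have [N HN] := HC (T - M)%R (eq_ind_r is_true MT (subr_ge0 _ _)).
rewrite -!mulrA -expRD -mulrN -mulrDr [(- M + T)%R]addrC.
rewrite EFinM lee_pdivrMl// .
pose F w : \bar R := if w \in [set w | B w /\ (- T <= r w)%R] then 1 else 0.
have F0 w : 0 <= F w by rewrite /F; case: ifP.
have countE : end_count T = \esum_(w in setT) F w by rewrite /end_count esum_mkcond.
apply: (le_trans HN).
apply: (@le_trans _ _ (\esum_(w in setT) (lev 0 (T - M) w)%:E)).
  exact: sum_wsum_le_esum.
apply: (@le_trans _ _ (k%:E * end_count T)); last first.
  by rewrite lee_wpmul2r ?lee_fin ?lerDl// countE esum_ge0.
rewrite countE; apply: esum_link => // u; rewrite /level.
case: ifP => [/andP[Au Gu]|_]; last by rewrite sume_ge0.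
have [t tOm [But rut]] := HM u Au; rewrite mul0r expR0.
rewrite (big_rem t)//= {1}/F mem_set; first by rewrite leeDl// sume_ge0.
by split => //; lra.
Qed.

(** On words of length [n], [G] is at most [- b n], so raising the exponent from [del] to [x] gains
    [q ^+ n] against partition sums bounded by [D]. *)
Lemma end_series_cvg x : (del < x)%R ->
  \esum_(w in B) (expR (x * r w))%:E < +oo.
Proof.
move=> delx; have x0 : (0 < x)%R by exact: lt_trans delx.
have b0 := wp_b wp.
pose q := expR (- ((x - del) * b))%R.
have q0 : (0 < q)%R by exact: expR_gt0.
have q1 : (0 < 1 - q)%R by rewrite subr_gt0 expR_lt1 oppr_lt0 mulr_gt0// subr_gt0.
have D0 : (0 <= D)%R.
  by have /andP[h1 h2] := ZD 0; rewrite -lee_fin (le_trans _ (le_trans h1 h2)).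
have wt0 y w : 0 <= (wt y w)%:E by rewrite lee_fin weight_ge0.
apply: (@le_lt_trans _ _ (\esum_(w in setT)
    ((expR (x * K1))%:E * (wt x w)%:E))).
  rewrite esum_mkcond; apply: le_esum => w _.
  case: ifP => [/set_mem Bw|_]; last by rewrite mule_ge0// lee_fin expR_ge0.
  rewrite -EFinM lee_fin /weight BA// -expRD ler_expR -mulrDr.
  by rewrite ler_wpM2l ?(ltW x0)//; have := rG_le Bw; lra.
rewrite esumZl ?expR_ge0//.
apply: (@le_lt_trans _ _ ((expR (x * K1))%:E * (D * (1 - q)^-1)%:E)); last first.
  by rewrite -EFinM ltry.
rewrite lee_wpmul2l ?lee_fin ?expR_ge0//; apply: esum_le_wsum => // N.
apply: (@le_trans _ _ (\sum_(n < N) (q ^+ n * D)%:E)).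
  apply: lee_sum => n _.
  apply: (@le_trans _ _ ((q ^+ n)%:E * Z del n)).
    rewrite -wsumZ ?exprn_ge0 ?(ltW q0)//; apply: le_wsum => w wn.
    rewrite -EFinM lee_fin /weight; case: ifP => Aw; last by rewrite mulr0.
    rewrite -expRM_natl -expRD ler_expR.
    have := wp_decay wp Aw; rewrite wn => Gn.
    have : (0 <= (x - del) * (- (b * n%:R) - G w))%R.
      by rewrite mulr_ge0 ?subr_ge0// ltW.
    by rewrite -mulr_natl; lra.
  rewrite EFinM lee_wpmul2l ?lee_fin ?exprn_ge0 ?(ltW q0)//.
  by have /andP[] := ZD n.
rewrite sumEFin lee_fin -mulr_suml mulrC ler_wpM2l// geometric_sum_le//.
by rewrite (ltW q0) -subr_gt0.
Qed.

(** As [r] is nonpositive, lowering the exponent from [del] to [x] only increases the terms; at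
    [del] every length contributes at least 1 before the words are closed up. *)
Lemma end_series_dvg x : (forall w, B w -> r w <= 0)%R -> (x <= del)%R ->
  \esum_(w in B) (expR (x * r w))%:E = +oo.
Proof.
move=> r0 xdel; have [M M0 HM] := end_link_loss.
have wt0 y w : 0 <= (wt y w)%:E by rewrite lee_fin weight_ge0.
pose k : R := (size Om)%:R.
pose c := expR (del * M).
pose F w : \bar R := if w \in B then (expR (x * r w))%:E else 0.
have F0 w : 0 <= F w by rewrite /F; case: ifP => // _; rewrite lee_fin expR_ge0.
have F0' w : 0 <= c%:E * F w by rewrite mule_ge0// lee_fin expR_ge0.
have le_tot N : N%:R%:E <= k%:E * (c%:E * \esum_(w in B) (expR (x * r w))%:E).
  rewrite (esum_mkcond B) -/F -esumZl ?expR_ge0//.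
  apply: le_trans (esum_link (wt0 del) F0' _); last first.
    move=> u; rewrite {1}/weight; case: ifP => [Au|_]; last by rewrite sume_ge0.
    have [t tOm [But rut]] := HM u Au.
    rewrite (big_rem t)//= {1}/F mem_set//.
    apply: (@le_trans _ _ (c%:E * (expR (x * r (u ++ t)))%:E)); last first.
      by rewrite leeDl// sume_ge0.
    rewrite -EFinM lee_fin -expRD ler_expR.
    have h1 : (0 <= (del - x) * - r (u ++ t))%R.
      by rewrite mulr_ge0 ?subr_ge0// oppr_ge0 r0.
    have : (0 <= del * (r (u ++ t) - (G u - M)))%R.
      by rewrite mulr_ge0 ?subr_ge0// ltW.
    by lra.
  apply: le_trans (sum_wsum_le_esum N (wt0 del)).
  rewrite -[N in leLHS]card_ord -sumr_const -sumEFin.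
  by apply: lee_sum => n _; have /andP[] := ZD n.
apply/eqP; rewrite -leye_eq leNgt; apply/negP => fin.
move: le_tot; set S := k%:E * _ => le_tot.
have /fineK Sfin : S \is a fin_num.
  rewrite !fin_numM// ge0_fin_numE//; apply: esum_ge0 => w _.
  by rewrite lee_fin expR_ge0.
have := le_tot (Num.truncn (fine S)).+1.
by rewrite -[leRHS]Sfin lee_fin leNgt truncnS_gt.
Qed.

End EndWords.

(** * Potentials on sequences *)

Section Words.
Context {R : realType} {E : countType} (A : rel E).
Implicit Types (u v w t : seq E) (rho tau : nat -> E) (g : (nat -> E) -> R).

Lemma iter_left_shift n tau i : iter n (@left_shift E) tau i = tau (n + i)%N.
Proof.
elim: n tau i => [//|n IH] tau i.
by rewrite iterS /left_shift IH addnS addSn.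
Qed.

Lemma seqs_iter_shift n tau : seqs A tau -> seqs A (iter n (@left_shift E) tau).
Proof. by move=> Atau i; rewrite !iter_left_shift addnS; exact: Atau. Qed.

Lemma birkhoffD g n m tau :
  birkhoff g (n + m) tau = birkhoff g n tau + birkhoff g m (iter n (@left_shift E) tau).
Proof.
rewrite /birkhoff big_split_ord/=; congr (_ + _).
by apply: eq_bigr => i _; rewrite addnC iterD.
Qed.

Lemma seqs_cat_seq w rho : seqs A rho -> sorted A (rcons w (rho 0%N)) ->
  seqs A (cat_seq w rho).
Proof.
move=> Arho /(sortedP (rho 0%N)) Aw i; rewrite /cat_seq.
have := Aw i; rewrite size_rcons ltnS !nth_rcons.
have [iw|wi _] := ltnP i (size w); last first.
  by rewrite ltnNge (leqW wi)/= subSn.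
have [e|i1w] := eqVneq i.+1 (size w); first by rewrite e ltnn subnn => ->.
have -> : (i.+1 < size w)%N by rewrite ltn_neqAle i1w.
exact.
Qed.

Lemma cylinder_cat_seq w rho : seqs A (cat_seq w rho) -> cylinder A w (cat_seq w rho).
Proof.
move=> Aw; split => // i iw; rewrite /cat_seq iw; apply: set_nth_default.
by [].
Qed.

Lemma cylinder_sorted w tau : cylinder A w tau -> sorted A w.
Proof.
move=> [Atau tauw]; apply/(sortedP (tau 0%N)) => i iw.
by rewrite -!tauw//; exact: ltnW.
Qed.

Lemma cylinder_catl u v tau : cylinder A (u ++ v) tau -> cylinder A u tau.
Proof.
move=> [Atau tauuv]; split => // i iu; rewrite tauuv; last first.
  by rewrite size_cat ltn_addr.
by rewrite nth_cat iu.
Qed.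

Lemma cylinder_catr u v tau : cylinder A (u ++ v) tau ->
  cylinder A v (iter (size u) (@left_shift E) tau).
Proof.
move=> [Atau tauuv]; split; first exact: seqs_iter_shift.
move=> i iv; rewrite !iter_left_shift tauuv; last by rewrite size_cat ltn_add2l.
by rewrite nth_cat ltnNge leq_addr/= addKn; exact: set_nth_default.
Qed.

Lemma link_exists rho : finitely_irreducible A -> exists Om : seq (seq E),
  (forall t, t \in Om -> t != [::]) /\
  forall u v, sorted A u -> sorted A v ->
    exists2 t, t \in Om & sorted A (u ++ t ++ v).
Proof.
move=> [Om [Omw Oml]]; exists Om; split => [t /Omw[]//|u v Au Av].
(* The letter [rho 0] is the default end letter when [u] or [v] is empty. *)
have [t tOm [_ /= Ht]] := Oml (last (rho 0%N) u) (head (rho 0%N) v).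
exists t => //.
have {}Ht : path A (last (rho 0%N) u) (t ++ v).
  case: v Av Ht => [|e v] /= Av; first by rewrite cats0 rcons_path => /andP[].
  by rewrite -cat_rcons cat_path => ->; rewrite last_rcons.
case: u Au Ht => [|e u] /= Au Ht; first exact: path_sorted Ht.
by rewrite cat_path Au.
Qed.

Lemma sorted_prefix rho n : seqs A rho -> sorted A (mkseq rho n).
Proof.
move=> Arho; apply/(sortedP (rho 0%N)) => i; rewrite size_mkseq => iN.
by rewrite !nth_mkseq//; exact: ltnW.
Qed.

End Words.

(** * Birkhoff sums maximised over cylinders *)

Section WordSup.
Context {R : realType} {E : countType} {A : rel E} {g : (nat -> E) -> R} {b K : R}.
Context {Om : seq (seq E)} {rho : nat -> E}.
Hypothesis b0 : 0 < b.
Hypothesis gb : forall tau, seqs A tau -> g tau <= - b.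
Hypothesis gK : forall w tau tau', cylinder A w tau -> cylinder A w tau' ->
  birkhoff g (size w) tau - birkhoff g (size w) tau' <= K.
Hypothesis Arho : seqs A rho.
Hypothesis Om0 : forall t, t \in Om -> t != [::].
Hypothesis Oml : forall u v, sorted A u -> sorted A v ->
    exists2 t, t \in Om & sorted A (u ++ t ++ v).
Implicit Types (u v w t : seq E) (tau : nat -> E).

(** Real-valued; on a word with empty cylinder it takes a default value, which [weight] ignores. *)
Definition word_sup w : R := sup [set birkhoff g (size w) tau | tau in cylinder A w].

Lemma end_link u : sorted A u -> exists2 t, t \in Om & words_before A rho (u ++ t).
Proof.
move=> Au; have [t tOm Aut] := Oml Au (isT : sorted A [:: rho 0%N]); exists t => //.
have Aut' : sorted A (rcons (u ++ t) (rho 0%N)) by rewrite -cats1 -catA.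
split; last by apply: seqs_cat_seq.
split; first by rewrite -size_eq0 size_cat addn_eq0 !size_eq0 (negbTE (Om0 tOm)) andbF.
by apply: (sorted_catl (v := [:: rho 0%N])); rewrite cats1.
Qed.

Lemma cylinder_nonempty w : sorted A w -> cylinder A w !=set0.
Proof.
move=> /end_link[t _ [_ Awt]]; exists (cat_seq (w ++ t) rho).
exact: cylinder_catl (cylinder_cat_seq Awt).
Qed.

Lemma birkhoff_le n tau : seqs A tau -> birkhoff g n tau <= - (b * n%:R).
Proof.
move=> Atau; rewrite -mulNr mulr_natr -[n in leRHS]card_ord -sumr_const.
by apply: ler_sum => i _; apply: gb; exact: seqs_iter_shift.
Qed.

Lemma word_sup_has_sup w : sorted A w ->
  has_sup [set birkhoff g (size w) tau | tau in cylinder A w].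
Proof.
move=> Aw; split.
  by have [tau ctau] := cylinder_nonempty Aw; exists (birkhoff g (size w) tau), tau.
by exists (- (b * (size w)%:R)) => _ [tau [Atau _] <-]; exact: birkhoff_le.
Qed.

Lemma word_sup_ge w tau : cylinder A w tau -> birkhoff g (size w) tau <= word_sup w.
Proof.
move=> ctau; have [_ ub] := word_sup_has_sup (cylinder_sorted ctau).
by apply: ub_le_sup => //; exists tau.
Qed.

Lemma word_sup_le w x : sorted A w ->
  (forall tau, cylinder A w tau -> birkhoff g (size w) tau <= x) -> word_sup w <= x.
Proof.
move=> Aw wx; have [ne _] := word_sup_has_sup Aw.
by apply: ge_sup => // _ [tau ctau <-]; exact: wx.
Qed.

Lemma word_sup_near w tau : cylinder A w tau -> word_sup w - K <= birkhoff g (size w) tau.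
Proof.
move=> ctau; rewrite lerBlDr; apply: word_sup_le (cylinder_sorted ctau) _.
by move=> tau' ctau'; have := gK ctau' ctau; lra.
Qed.

(** A point of the cylinder of [u ++ v] nearly attains both suprema, with an error [K] for each
    factor; hence the constant [K + K]. *)
Lemma word_sup_potential : word_potential A word_sup b (K + K) Om.
Proof.
split => //.
- apply/eqP; rewrite eq_le; apply/andP; split.
    by apply: word_sup_le => // tau _; rewrite /birkhoff big_ord0.
  rewrite -[0](_ : birkhoff g 0 rho = 0); last by rewrite /birkhoff big_ord0.
  by apply: (@word_sup_ge [::]); split.
- move=> w Aw; apply: word_sup_le => // tau [Atau _]; exact: birkhoff_le.
- move=> u v Auv; apply: word_sup_le => // tau ctau.
  rewrite size_cat birkhoffD; apply: lerD.
    exact/word_sup_ge/(cylinder_catl ctau).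
  exact/word_sup_ge/cylinder_catr.
- move=> u v Auv; have [tau ctau] := cylinder_nonempty Auv.
  apply: le_trans (word_sup_ge ctau); rewrite size_cat birkhoffD.
  have := word_sup_near (cylinder_catl ctau).
  by have := word_sup_near (cylinder_catr ctau); lra.
Qed.

(** The length is positive because [nwords] excludes the empty word, which [Zsum] counts with weight
    1. *)
Lemma partition_sumE (x : R) n : 0 < x -> (0 < n)%N ->
  partition_sum A g x n = Zsum (A := A) (G := word_sup) x n.
Proof.
move=> x0 n0; rewrite /partition_sum /Zsum /wsum esum_mkcond [RHS]esum_mkcond.
apply: eq_esum => w _.
have -> : w \in nwords A n = (w \in [set w | size w = n]) && sorted A w.
  apply/idP/andP => [/set_mem[[_ Aw] wn]|[/set_mem/= wn Aw]].
    by split=> //; exact/mem_set.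
  apply/mem_set; split => //; split => //.
  by rewrite -size_eq0 wn -lt0n.
case: ifP => [/andP[/set_mem/= wn Aw]|]; last first.
  by case: ifP => //= _; rewrite /weight => ->.
rewrite mem_set// /weight Aw -wn.
have [ne ub] := word_sup_has_sup Aw.
rewrite -[X in ereal_sup X](image_comp (fun tau => birkhoff g (size w) tau) EFin).
by rewrite ereal_sup_EFin.
Qed.

End WordSup.

(** * From strong regularity to bounds on partition sums *)

Section Pressure.
Context {R : realType} {E : countType} {A : rel E} {g : (nat -> E) -> R} {b K : R}.
Context {Om : seq (seq E)} {rho : nat -> E}.
Hypothesis b0 : 0 < b.
Hypothesis gb : forall tau, seqs A tau -> g tau <= - b.
Hypothesis gK : forall w tau tau', cylinder A w tau -> cylinder A w tau' ->
  birkhoff g (size w) tau - birkhoff g (size w) tau' <= K.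
Hypothesis Arho : seqs A rho.
Hypothesis Om0 : forall t, t \in Om -> t != [::].
Hypothesis Oml : forall u v, sorted A u -> sorted A v ->
    exists2 t, t \in Om & sorted A (u ++ t ++ v).
Implicit Types (u v w t : seq E) (tau : nat -> E) (x s : R).
Local Open Scope ereal_scope.

Local Notation G := (word_sup (A := A) (g := g)).
Local Notation Z := (Zsum (A := A) (G := G)).
Local Notation wt := (weight (A := A) (G := G)).

Let wp : word_potential A G b (K + K) Om := word_sup_potential b0 gb gK Arho Om0 Oml.

(** Each letter is continued to length [n.+1] by one of finitely many words, a linking word followed
    by a prefix of [rho], cut to length [n]; this changes weights by a bounded factor. *)
Lemma Zsum1_fin x n : (0 <= x)%R -> Z x n.+1 < +oo -> Z x 1 < +oo.
Proof.
move=> x0 Zn.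
have wt0 w : 0 <= (wt x w)%:E by rewrite lee_fin weight_ge0.
pose y t := take n (t ++ mkseq rho n).
have sy t : size (y t) = n.
  by rewrite size_takel// size_cat size_mkseq leq_addl.
pose c t := expR (x * (K + K - G (y t))).
apply: (@le_lt_trans _ _ (wsum 1 (fun e =>
    \sum_(t <- Om) (c t)%:E * (wt x (e ++ y t))%:E))).
  apply: le_wsum => e e1; rewrite {1}/weight; case: ifP => Ae; last first.
    by rewrite sume_ge0// => t _; rewrite mule_ge0// lee_fin expR_ge0.
  have [t tOm Aet] := Oml Ae (sorted_prefix n Arho).
  rewrite (big_rem t)//=.
  have Aey : sorted A (e ++ y t).
    apply: (@sorted_catl _ _ _ (drop n (t ++ mkseq rho n))).
    by rewrite -catA cat_take_drop.
  apply: (@le_trans _ _ ((c t)%:E * (wt x (e ++ y t))%:E)).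
    rewrite -EFinM lee_fin /weight Aey -expRD ler_expR -mulrDr ler_wpM2l//.
    by have := wp_super wp Aey; lra.
  rewrite leeDl// sume_ge0// => t' _; rewrite mule_ge0// lee_fin expR_ge0//.
rewrite wsum_sum; last by move=> w t; rewrite mule_ge0// lee_fin expR_ge0.
apply: (@le_lt_trans _ _ (\sum_(t <- Om) (c t)%:E * Z x n.+1)).
  apply: lee_sum => t _; rewrite wsumZ ?expR_ge0// lee_wpmul2l ?lee_fin ?expR_ge0//.
  rewrite /Zsum -[n.+1]add1n wsum_add//; apply: le_wsum => e _.
  rewrite -(sy t).
  exact: (wsum_le1 (F := fun v => (wt x (e ++ v))%:E)).
apply: lte_sum_pinfty => t _; rewrite lte_mul_pinfty// ?lee_fin ?expR_ge0//.
Qed.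

Lemma pressure_Zsum x (p : \bar R) : (0 < x)%R -> pressure_is A g x p ->
  (fun n : nat => (n%:R^-1)%:E * lne (Z x n)) @ \oo --> p.
Proof.
move=> x0; apply: cvg_trans; apply: near_eq_cvg; near=> n.
rewrite (partition_sumE gb Arho Om0 Oml x0)//.
by near: n; exact: nbhs_infty_gt.
Unshelve. all: by end_near. Qed.

Lemma strongly_regular_Zsum : strongly_regular A g ->
  exists del s D : R, [/\ (0 < del)%R, (0 <= s < del)%R, Z s 1 < +oo,
    Z del 1 < +oo & forall n, 1 <= Z del n <= D%:E].
Proof.
move=> [[del [del0 Pdel]] [s [p [s0 Ps p0 py]]]].
have {}Pdel := pressure_Zsum del0 Pdel; have {}Ps := pressure_Zsum s0 Ps.
(* Partition sums do not increase with the exponent, so positive pressure occurs only to the left of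
   a zero. *)
have sdel : (s < del)%R.
  rewrite ltNge; apply/negP => dels.
  suff : p <= 0 by rewrite leNgt p0.
  rewrite -(cvg_lim _ Pdel)// -(cvg_lim _ Ps)//.
  apply: lee_lim; [by apply/cvg_ex; exists p|by apply/cvg_ex; exists 0|].
  near=> n; rewrite lee_wpmul2l ?lee_fin ?invr_ge0//.
  rewrite lee_lne ?in_itv/= ?Zsum_ge0 ?leey//.
  exact: (Zsum_anti wp).
have pfin : p \is a fin_num by rewrite ge0_fin_numE// ltW.
have Zs1 : Z s 1 < +oo.
  (* Convergence to a finite limit makes the terms eventually finite, which rules out an infinite
     partition sum at a positive index. *)
  move: Ps; rewrite -(fineK pfin) => /cvg_is_fine [N _ HN].
  apply: (Zsum1_fin (n := N)); first exact: ltW.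
  have := HN N.+1 (leqnSn N); rewrite ltey; apply: contraTneq => -> /=.
  by rewrite gt0_muley// lte_fin invr_gt0.
have Zd1 : Z del 1 < +oo.
  by apply: le_lt_trans Zs1; apply: (Zsum_anti wp); exact: ltW.
have [D D0 HD] := Zsum_bounds wp (ltW del0) Zd1
  (fun n => ex_intro2 _ _ (mkseq rho n) (size_mkseq _ _) (sorted_prefix n Arho)) Pdel.
by exists del, s, D; split=> //; rewrite (ltW s0).
Unshelve. all: by end_near. Qed.

End Pressure.

(** * The geometric potential *)

Section EuclideanNorm.
Context {R : realType} {d : nat}.
Implicit Types (v : 'rV[R]_d).

Lemma enorm_ge0 v : 0 <= enorm v.
Proof. exact: sqrtr_ge0. Qed.

Lemma enormZ (a : R) v : enorm (a *: v) = `|a| * enorm v.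
Proof.
rewrite /enorm; under eq_bigr do rewrite mxE exprMn.
by rewrite -mulr_sumr sqrtrM ?sqr_ge0// sqrtr_sqr.
Qed.

Lemma enorm_continuous : continuous (@enorm R d).
Proof.
have sumc (s : seq 'I_d) (v : 'rV[R]_d) :
    (fun v => \sum_(j <- s) v 0 j ^+ 2) @ v --> \sum_(j <- s) v 0 j ^+ 2.
  elim: s => [|j s IH].
    rewrite (_ : (fun _ => _) = cst 0); last first.
      by apply/funext => w; rewrite big_nil.
    by rewrite big_nil; exact: cst_continuous.
  rewrite (_ : (fun _ => _) = (fun w : 'rV[R]_d => w 0 j * w 0 j +
      \sum_(j <- s) w 0 j ^+ 2)); last first.
    by apply/funext => w; rewrite big_cons expr2.
  rewrite big_cons expr2; apply: (@cvgD _ _ _ (nbhs v) (nbhs_filter v)); last exact: IH.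
  by apply: (@cvgM _ _ (nbhs v) (nbhs_filter v)); exact: coord_continuous.
move=> v; apply: (@continuous_comp _ _ _ (fun v => \sum_(j < d) v 0 j ^+ 2) Num.sqrt).
  exact: sumc.
exact: sqrt_continuous.
Qed.

Lemma enorm_bounded (X : set 'rV[R]_d) : compact X ->
  exists2 M : R, 0 <= M & forall x y, X x -> X y -> enorm (x - y) <= M.
Proof.
move=> cX.
have : compact ((fun p : 'rV[R]_d * 'rV[R]_d => enorm (p.1 - p.2)) @` (X `*` X)).
  apply: continuous_compact; last exact: compact_setX.
  apply: continuous_subspaceT => p.
  apply: (@continuous_comp _ _ _ (fun p : 'rV[R]_d * 'rV[R]_d => p.1 - p.2)).
    by apply: continuousB => /=; [exact: cvg_fst|exact: cvg_snd].
  exact: enorm_continuous.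
move=> /compact_bounded[M [_ HM]].
exists (`|M| + 1); first by rewrite addr_ge0.
move=> x y Xx Xy; apply: le_trans (ler_norm _) _.
apply: (HM (`|M| + 1)); first by rewrite ltr_pwDr// ler_norm.
by exists (x, y).
Qed.

(* The derivative inherits the Lipschitz bound, so the similarity ratio is at most [k]. *)
Lemma scaling_factor_bounds (W : set 'rV[R]_d) (f : 'rV[R]_d -> 'rV[R]_d) (k : R) x :
  (0 < d)%N -> open W -> W x -> differentiable f x -> conformal_on W f ->
  lipschitz_at_most W k f -> 0 < scaling_factor f x <= k.
Proof.
move=> d0 oW Wx dfx /(_ _ Wx)[r0 fr0] lipf.
have [r_gt0 fr] : is_scaling ('d f x) (scaling_factor f x).
  by rewrite /scaling_factor; apply: xgetPex; exists r0.
rewrite r_gt0/=; set r := scaling_factor f x in r_gt0 fr *.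
pose v : 'rV[R]_d := delta_mx 0 (Ordinal d0).
have v1 : enorm v = 1.
  rewrite /enorm (bigD1 (Ordinal d0))//= big1 => [|j jN].
    by rewrite mxE !eqxx addr0 expr1n sqrtr1.
  by rewrite mxE (negbTE jN) andbF expr0n.
have dv : (fun h => enorm (h^-1 *: ((f \o shift x) (h *: v) - f x))) @ (0 : R)^' --> r.
  have -> : r = enorm ('d f x v) by rewrite fr v1 mulr1.
  apply: continuous_cvg; first exact: enorm_continuous.
  by rewrite -deriveE//; exact: (diff_derivable (v := v) dfx).
apply: (cvgr_to_le dv).
have nW : \forall h \near (0 : R)^', W (h *: v + x).
  apply: nbhs_dnbhs.
  have c : {for (0 : R), continuous (fun h : R => h *: v + x)}.
    by apply: cvgD; [apply: cvgZr_tmp; exact: cvg_id|exact: cvg_cst].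
  apply: c; rewrite scale0r add0r; exact: open_nbhs_nbhs.
near=> h.
have h0 : h != 0 by near: h; exact: nbhs_dnbhs_neq.
rewrite enormZ normfV ler_pdivrMl ?normr_gt0//.
have Wh : W (h *: v + x) by near: h.
apply: le_trans (lipf _ _ Wh Wx) _.
by rewrite addrK enormZ v1 mulr1 mulrC.
Unshelve. all: by end_near. Qed.

End EuclideanNorm.

Lemma ln_sub_le (R : realType) (x y : R) : 0 < x -> 0 < y -> ln x - ln y <= x / y - 1.
Proof.
move=> x0 y0; have xy0 : 0 < x / y by rewrite divr_gt0.
rewrite -ln_div ?posrE// -{1}[x / y](subrKC 1) le_ln1Dx//.
by rewrite ltrBrDl subrr.
Qed.

Lemma powR_exprn (R : realType) (x y : R) n : 0 <= x ->
  (x ^+ n) `^ y = (x `^ y) ^+ n.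
Proof. by move=> x0; rewrite -!powR_mulrn ?powR_ge0// -!powRrM mulrC. Qed.

(** * Coding map and bounded distortion of the system *)

Section CIFSPotential.
Context {R : realType} {d : nat} {E : countType} {A : rel E}.
Context {X : set 'rV[R]_d} {phi : E -> 'rV[R]_d -> 'rV[R]_d} {kappa L alpha : R}.
Hypothesis d0 : (0 < d)%N.
Hypothesis cifs : is_CIFS X phi kappa L alpha.
Implicit Types (rho tau : nat -> E).

Lemma compose_alongS n rho x :
  compose_along phi n.+1 rho x = compose_along phi n rho (phi (rho n) x).
Proof.
elim: n rho x => [//|n IH] rho x.
exact: (congr1 (phi (rho 0%N)) (IH (left_shift rho) x)).
Qed.

Lemma compose_along_eq n rho tau : (forall i, (i < n)%N -> rho i = tau i) ->
  compose_along phi n rho = compose_along phi n tau.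
Proof.
elim: n rho tau => [//|n IH] rho tau e /=.
by rewrite (e 0%N)// (IH _ (left_shift tau))// => i iN; exact: (e i.+1).
Qed.

Lemma compose_along_maps n rho x : X x -> X (compose_along phi n rho x).
Proof.
by elim: n rho => [//|n IH] rho Xx /=; apply: (cifs_maps cifs); exact: IH.
Qed.

Lemma compose_along_contract n rho x y : X x -> X y ->
  enorm (compose_along phi n rho x - compose_along phi n rho y)
    <= kappa ^+ n * enorm (x - y).
Proof.
move=> Xx Xy; elim: n rho => [|n IH] rho /=; first by rewrite expr0 mul1r.
have lip := cifs_contract cifs (rho 0%N).
apply: le_trans (lip _ _ (compose_along_maps n _ Xx) (compose_along_maps n _ Xy)) _.
have /andP[/ltW k0 _] := cifs_kappa cifs.
by rewrite exprS -mulrA ler_wpM2l.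
Qed.

Lemma compose_along_continuous n rho x : X x ->
  {for x, continuous (compose_along phi n rho)}.
Proof.
move=> Xx; elim: n rho => [|n IH] rho; first exact: cvg_id.
apply: continuous_comp; first exact: IH.
apply: differentiable_continuous.
have [W [_ _ XW /(_ (rho 0%N))[_ [C1 _ _] _ _]]] := cifs_ext cifs.
by have [] := C1 _ (XW _ (compose_along_maps n (left_shift rho) Xx)).
Qed.

(** By compactness the images of one point have a cluster point; it lies in every set of the
    intersection, since these sets are closed and contain the tails. So [xget] returns a point of
    the intersection. *)
Lemma coding_in rho n : (0 < n)%N -> (compose_along phi n rho @` X) (coding X phi rho).
Proof.
suff : (\bigcap_(n in [set n | (0 < n)%N]) (compose_along phi n rho @` X)) !=set0.
  by move=> /(xgetPex 0) h n0; exact: (h n).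
have [x0 Xx0] := cifs_nonempty cifs.
pose u n := compose_along phi n rho x0.
have uX : (u @ \oo) X by exists 0%N => // m _; exact: compose_along_maps.
have [p [Xp clp]] := cifs_compact cifs (fmap_proper_filter _ _) uX.
exists p => m _.
have : closed (compose_along phi m rho @` X).
  apply: compact_closed; first exact: norm_hausdorff.
  apply: continuous_compact (cifs_compact cifs).
  by apply: continuous_in_subspaceT => x /set_mem; exact: compose_along_continuous.
apply => B Bp; apply: clp Bp; exists m => // k /= mk.
(* The maps beyond the first [m] are absorbed into the base point, which therefore varies in the
   induction. *)
rewrite /u -(subnKC mk); elim: (k - m)%N x0 Xx0 {u uX} => [|j IH] x0 Xx0.
  by rewrite addn0; exists x0.
by rewrite addnS compose_alongS; apply: IH; exact: (cifs_maps cifs).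
Qed.

Lemma coding_mem rho : X (coding X phi rho).
Proof. by have [x Xx <-] := coding_in rho (ltn0Sn 0); exact: compose_along_maps. Qed.

Lemma scaling_factor_cifs e x : X x -> 0 < scaling_factor (phi e) x <= kappa.
Proof.
move=> Xx; have [W [oW _ XW /(_ e)[_ [C1 _ _] conf lip]]] := cifs_ext cifs.
apply: (scaling_factor_bounds d0 oW (XW _ Xx)) => //.
by have [] := C1 _ (XW _ Xx).
Qed.

Lemma potential_le rho : potential X phi rho <= ln kappa.
Proof.
have /andP[s0 sk] := scaling_factor_cifs (rho 0%N) (coding_mem (left_shift rho)).
by rewrite /potential ler_ln ?posrE// (lt_le_trans s0).
Qed.

(** The first common letter selects the same map; the other [n] put both coding points into one
    image of [X] of diameter at most [kappa ^+ n * M]. The Hölder distortion bound then applies. *)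
Lemma potential_variation : exists2 C : R, 0 <= C & forall n rho tau,
  (forall i, (i < n.+1)%N -> rho i = tau i) ->
  potential X phi rho - potential X phi tau <= C * (kappa `^ alpha) ^+ n.
Proof.
have [M M0 HM] := enorm_bounded (cifs_compact cifs).
have L0 : 0 <= L by exact: le_trans (cifs_L cifs).
have /andP[k0 _] := cifs_kappa cifs.
exists (L * M `^ alpha); first by rewrite mulr_ge0// powR_ge0.
move=> n rho tau e; rewrite /potential (e 0%N)//.
set s := coding X phi (left_shift rho); set t := coding X phi (left_shift tau).
have [Xs Xt] : X s /\ X t by split; exact: coding_mem.
have /andP[s0 _] := scaling_factor_cifs (tau 0%N) Xs.
have /andP[t0 _] := scaling_factor_cifs (tau 0%N) Xt.
have st : enorm (s - t) <= kappa ^+ n * M.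
  (* [coding_in] needs a positive length, so for [n = 0] the diameter bound of [X] is used
     directly. *)
  case: n e => [|n] e; first by rewrite mul1r HM.
  have [x Xx xs] := coding_in (left_shift rho) (ltn0Sn n).
  have [y Xy yt] := coding_in (left_shift tau) (ltn0Sn n).
  rewrite /s /t -xs -yt.
  rewrite (@compose_along_eq _ (left_shift rho) (left_shift tau)); last first.
    by move=> i iN; exact: (e i.+1).
  apply: le_trans (compose_along_contract _ _ Xx Xy) _.
  by rewrite ler_wpM2l ?exprn_ge0 ?(ltW k0)// HM.
apply: le_trans (ln_sub_le s0 t0) _.
apply: le_trans (ler_norm _) _; apply: le_trans (cifs_distortion cifs _ Xs Xt) _.
rewrite -mulrA ler_wpM2l//.
apply: le_trans (_ : (kappa ^+ n * M) `^ alpha <= _).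
  apply: ge0_ler_powR => //; first exact/ltW/(cifs_alpha cifs).
    exact: enorm_ge0.
  by rewrite nnegrE mulr_ge0// exprn_ge0// ltW.
rewrite powRM ?exprn_ge0 ?(ltW k0)// mulrC ler_wpM2l ?powR_ge0//.
by rewrite powR_exprn// ltW.
Qed.

(** After [i] shifts the sequences still share [size w - i] letters, so the differences are bounded
    by a geometric series read backwards. *)
Lemma birkhoff_distortion : exists K : R, forall w tau tau',
  cylinder A w tau -> cylinder A w tau' ->
  birkhoff (potential X phi) (size w) tau - birkhoff (potential X phi) (size w) tau' <= K.
Proof.
have [C C0 HC] := potential_variation.
set q := kappa `^ alpha in HC.
have q01 : 0 <= q < 1.
  have /andP[k0 k1] := cifs_kappa cifs.
  rewrite powR_ge0/= /q /powR gt_eqF// expR_lt1 pmulr_rlt0 ?(cifs_alpha cifs)//.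
  by rewrite ln_lt0// k0.
exists (C * (1 - q)^-1) => w tau tau' [_ tw] [_ tw'].
rewrite /birkhoff -sumrB.
apply: (@le_trans _ _ (\sum_(i < size w) C * q ^+ (size w - i.+1))).
  apply: ler_sum => i _; apply: HC => j; rewrite -subSn// subSS => ji.
  rewrite !iter_left_shift; have ijw : (i + j < size w)%N by rewrite -ltn_subRL.
  by rewrite tw// tw'//; exact: set_nth_default.
rewrite -mulr_sumr ler_wpM2l//.
rewrite (reindex_inj rev_ord_inj)/=.
under eq_bigr => i _ do rewrite -subSn// subSS subKn ?(ltnW (ltn_ord i))//.
exact: geometric_sum_le.
Qed.

End CIFSPotential.

(** * Random perturbation of bounded fluctuation *)

Section RandomSum.
Context {R : realType} {a : nat} (z : 'I_a.+1 -> R[i]) (lambda : int -> 'I_a.+1).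

Lemma cmod_prod n (f : 'I_n -> R[i]) : cmod (\prod_k f k) = \prod_k cmod (f k).
Proof.
apply: (big_morph _ (ComplexField.Normc.normcM (R := R))).
by rewrite /cmod/= expr1n expr0n/= addr0 sqrtr1.
Qed.

Lemma ln_prod n (f : 'I_n -> R) : (forall k, 0 < f k) ->
  ln (\prod_k f k) = \sum_k ln (f k).
Proof.
move=> f0; elim: n f f0 => [|n IH] f f0; first by rewrite !big_ord0 ln1.
rewrite !big_ord_recl lnM ?posrE ?IH//.
by apply: prodr_gt0 => i _.
Qed.

Lemma sum_occurrences (F : 'I_a.+1 -> R) n :
  \sum_(k < n) F (lambda (k : nat)%:Z) = \sum_i (occurrences i n lambda)%:R * F i.
Proof.
rewrite (eq_bigr (fun k : 'I_n => \sum_i (lambda (k : nat)%:Z == i)%:R * F i)).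
  rewrite exchange_big/=; apply: eq_bigr => i _.
  by rewrite /occurrences natr_sum mulr_suml.
move=> k _; rewrite (bigD1 (lambda (k : nat)%:Z))//= eqxx mul1r big1 ?addr0//.
by move=> i /negbTE iN; rewrite eq_sym iN mul0r.
Qed.

Lemma random_sum_fluctuation (l : 'I_a -> R) : (forall i, 0 < cmod (z i)) ->
  bounded_fluctuation lambda l ->
  exists K : R, forall n, (0 < n)%N ->
    `|ln (cmod (\prod_(k < n) z (lambda (k : nat)%:Z))) - n%:R * mean_log z l| <= K.
Proof.
move=> z0 [_ [p [q pq]]].
pose y i := ln (cmod (z i)).
exists (\sum_j (`|p| + `|q|) * `|y (lift ord0 j) - y ord0|) => n n0.
rewrite cmod_prod ln_prod//.
have -> : \sum_(k < n) ln (cmod (z (lambda (k : nat)%:Z))) =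
    n%:R * y ord0 +
    \sum_j (occurrences (lift ord0 j) n lambda)%:R * (y (lift ord0 j) - y ord0).
  (* Subtracting [y ord0] from every letter cancels the occurrences of the first letter, leaving
     only those that bounded fluctuation controls. *)
  have := sum_occurrences (fun i => y i - y ord0) n.
  rewrite sumrB sumr_const card_ord big_ord_recl subrr mulr0 add0r => <-.
  by rewrite mulr_natl addrC subrK.
have -> : n%:R * mean_log z l = n%:R * y ord0 +
    \sum_j n%:R * l j * (y (lift ord0 j) - y ord0).
  rewrite /mean_log mulrDr mulrBl mul1r mulrBr -addrA; congr (_ + _).
  rewrite addrC mulr_suml -mulrBr -sumrB mulr_sumr; apply: eq_bigr => j _.
  by rewrite /y; ring.
rewrite opprD addrACA subrr add0r -sumrB; apply: le_trans (ler_norm_sum _ _ _) _.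
apply: ler_sum => j _; rewrite -mulrBl normrM ler_wpM2r//.
have /andP[h1 h2] := pq j n n0; rewrite ler_norml.
have := ler_norm q; have := ler_norm (- p); rewrite normrN.
have := normr_ge0 p; have := normr_ge0 q.
by move=> *; apply/andP; split; lra.
Qed.

Lemma mean_log_le0 (l : 'I_a -> R) : (forall i, 0 < cmod (z i) <= 1) ->
  bounded_fluctuation lambda l -> mean_log z l <= 0.
Proof.
move=> z01 bf.
have z0 i : 0 < cmod (z i) by have /andP[] := z01 i.
have [K HK] := random_sum_fluctuation z0 bf.
rewrite leNgt; apply/negP => c0.
pose n := (Num.truncn (K / mean_log z l)).+1.
have := HK n isT; rewrite leNgt => /negP; apply.
have cn : K < n%:R * mean_log z l by rewrite -ltr_pdivrMr// truncnS_gt.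
apply: lt_le_trans cn _.
rewrite -[leLHS]opprK -normrN opprB; apply: le_trans (ler_norm _).
rewrite opprK lerBrDr gerDl cmod_prod ln_prod//.
by apply: sumr_le0 => i _; have /andP[_ /ln_le0] := z01 (lambda (i : nat)%:Z).
Qed.

End RandomSum.

(** * Upper and lower limits along a filter *)

Section LimSup.
Context {R : realType} {T : choiceType} {X : filteredType T} {F : set_system X}.
Implicit Types (f : X -> \bar R) (x : \bar R).
Local Open Scope ereal_scope.

Lemma limf_esup_le f x : (\forall t \near F, f t <= x) -> limf_esup f F <= x.
Proof.
move=> fx; rewrite limf_esupE; apply: ge_ereal_inf.
exists (ereal_sup (f @` [set t | f t <= x])); first by exists [set t | f t <= x].
by apply: ge_ereal_sup => _ [t ft <-].
Qed.

Lemma limf_einf_ge f x : (\forall t \near F, x <= f t) -> x <= limf_einf f F.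
Proof.
move=> fx; rewrite limf_einfE; apply: le_ereal_sup_tmp.
exists (ereal_inf (f @` [set t | x <= f t])); first by exists [set t | x <= f t].
by apply: le_ereal_inf_tmp => _ [t ft <-].
Qed.

Lemma limf_einf_le_esup f : ProperFilter F -> limf_einf f F <= limf_esup f F.
Proof.
move=> FF; rewrite limf_esupE limf_einfE; apply: ge_ereal_sup => _ [U FU <-].
apply: le_ereal_inf_tmp => _ [V FV <-].
have [t [Ut Vt]] := filter_ex (filterI FU FV).
apply: (@le_trans _ _ (f t)); first by apply: ereal_inf_lbound; exists t.
by apply: ereal_sup_ubound; exists t.
Qed.

End LimSup.

(** * The Poincaré series and its abscissa *)

Section Poincare.
Context {R : realType} {a : nat} {E : countType} (A : rel E) (f : (nat -> E) -> R).
Context (z : 'I_a.+1 -> R[i]) (lambda : int -> 'I_a.+1) (rho : nat -> E).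
Local Open Scope ereal_scope.

Let r w := random_birkhoff f z lambda (size w) (cat_seq w rho).

Lemma poincareE (s : R) :
  poincare A f z lambda rho s = \esum_(w in words_before A rho) (expR (s * r w))%:E.
Proof.
pose F w := (expR (s * r w))%:E; have F0 w : 0 <= F w by rewrite lee_fin expR_ge0.
have F'0 n w : 0 <= (expR (s * random_birkhoff f z lambda n (cat_seq w rho)))%:E.
  by rewrite lee_fin expR_ge0.
(* The index 0 can be added, since no word before [rho] is empty. *)
transitivity (\sum_(0 <= n <oo) \esum_(w in nwords_before A n rho)
    (expR (s * random_birkhoff f z lambda n (cat_seq w rho)))%:E).
  rewrite nneseries_recl//; last by move=> n _; exact: esum_ge0.
  rewrite (_ : nwords_before A 0 rho = set0) ?esum_set0 ?add0e//.
  apply/seteqP; split => // w [[[/negP w0 _]]] /= /size0nil we _.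
  by apply: w0; rewrite we.
transitivity (\sum_(0 <= n <oo) \esum_(w in nwords_before A n rho) F w).
  apply: eq_eseriesr => n _; apply: eq_esum => w [[_ /= wn] _].
  by rewrite /F /r wn.
rewrite -nneseries_sum_bigcup//; last first.
  by move=> i j _ _ [w [[[_ /= <-] _] [[_ /= <-] _]]].
congr esum; apply/seteqP; split => [w [n _ [[ww _] wr]]//|w [ww wr]].
by exists (size w).
Qed.

Lemma abscissaE (del : R) :
  (forall s : R, (del < s)%R -> poincare A f z lambda rho s < +oo) ->
  (forall s : R, (s <= del)%R -> poincare A f z lambda rho s = +oo) ->
  abscissa A f z lambda rho = del%:E.
Proof.
move=> cvg_gt dvg_le; apply/eqP; rewrite eq_le; apply/andP; split.
  apply/lee_addgt0Pr => e e0; apply: ge_ereal_inf; exists (del + e)%:E => //.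
  by exists (del + e)%R => //; apply: cvg_gt; rewrite ltrDl.
apply: le_ereal_inf_tmp => _ [s sfin <-]; rewrite lee_fin leNgt.
by apply/negP => /ltW /dvg_le se; move: sfin; rewrite /= se ltxx.
Qed.

End Poincare.

(** * Assembly of the counting bounds *)

Section Symbolic.
Context {R : realType} {E : countType} {A : rel E}.
Implicit Types (tau : nat -> E).

Lemma birkhoff_addc (f : (nat -> E) -> R) (c : R) n tau :
  birkhoff (fun tau => f tau + c) n tau = birkhoff f n tau + n%:R * c.
Proof. by rewrite /birkhoff big_split/= sumr_const card_ord mulr_natl. Qed.

(** The symbolic core: the geometry enters only through the bound [- b] on the potential and the
    distortion constant [K]. *)
Lemma random_counting (f : (nat -> E) -> R) (b K : R) (a : nat)
  (z : 'I_a.+1 -> R[i]) (lambda : int -> 'I_a.+1) (l : 'I_a -> R) :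
  0 < b -> (forall tau, seqs A tau -> f tau <= - b) ->
  (forall w tau tau', cylinder A w tau -> cylinder A w tau' ->
    birkhoff f (size w) tau - birkhoff f (size w) tau' <= K) ->
  finitely_irreducible A ->
  (forall i, 0 < cmod (z i) <= 1) ->
  bounded_fluctuation lambda l ->
  strongly_regular A (fun rho => f rho + mean_log z l) ->
  forall rho : nat -> E, seqs A rho ->
  let delta := abscissa A (f) z lambda rho in
  let ratio (T : R) : \bar R :=
    (count_words A (f) z lambda rho T / expeR (delta * T%:E))%E in
  exists C D : R, [/\ 0 < C, 0 < D &
    [/\ (C%:E <= limf_einf ratio (pinfty_nbhs R))%E,
        (limf_einf ratio (pinfty_nbhs R) <= limf_esup ratio (pinfty_nbhs R))%E &
        (limf_esup ratio (pinfty_nbhs R) <= D%:E)%E]].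
Proof.
move=> b0 f_le HK Airr z01 bf greg rho Arho delta ratio.
have z0 i : 0 < cmod (z i) by have /andP[] := z01 i.
have c_le0 := mean_log_le0 z01 bf.
set c := mean_log z l in greg c_le0.
have gb tau : seqs A tau -> f tau + c <= - b by move=> /f_le; lra.
have gK w tau tau' : cylinder A w tau -> cylinder A w tau' ->
    birkhoff (fun tau => f tau + c) (size w) tau -
    birkhoff (fun tau => f tau + c) (size w) tau' <= K.
  by move=> ct ct'; rewrite !birkhoff_addc opprD addrACA subrr addr0; exact: HK.
have [Om [Om0 Oml]] := link_exists rho Airr.
have wp := word_sup_potential b0 gb gK Arho Om0 Oml.
have [del [s [D [del0 sdel Zs1 Zd1 ZD]]]] :=
  strongly_regular_Zsum b0 gb gK Arho Om0 Oml greg.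
have [K1 HK1] := random_sum_fluctuation z0 bf.
pose B := words_before A rho.
pose r w := random_birkhoff f z lambda (size w) (cat_seq w rho).
have BA w : B w -> sorted A w by move=> [[_ ->]].
have Bl u : sorted A u -> exists2 t, t \in Om & B (u ++ t).
  exact: (end_link Arho Om0 Oml).
(* The error combines the fluctuation [K1] of the random factors with the distortion [K] between one
   point and the supremum. *)
have rG w : B w -> `|r w - word_sup (A := A) (g := fun tau => f tau + c) w| <= K1 + K.
  move=> [[w0 _] /cylinder_cat_seq cw].
  have n0 : (0 < size w)%N by rewrite lt0n size_eq0.
  have := HK1 _ n0; have := word_sup_ge gb Arho Om0 Oml cw.
  have := word_sup_near gb gK Arho Om0 Oml cw.
  rewrite /r /random_birkhoff birkhoff_addc -/c !ler_norml => h1 h2 /andP[h3 h4].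
  by apply/andP; split; lra.
have r_le0 w : B w -> r w <= 0.
  move=> [_ Bw]; rewrite /r /random_birkhoff cmod_prod ln_prod// -big_split/=.
  apply: sumr_le0 => i _; have /andP[_ /ln_le0] := z01 (lambda (i : nat)%:Z).
  by have := f_le _ (seqs_iter_shift i Bw); lra.
(* The abscissa is identified with the zero of the pressure of [g], so the normalisation of the
   ratio is a finite positive number. *)
have deltaE : delta = del%:E.
  apply: abscissaE => x; rewrite poincareE -/B -/(r _) => xd.
    exact: (end_series_cvg wp BA rG del0 ZD).
  exact: (end_series_dvg wp BA Bl rG del0 ZD).
have countE T : count_words A f z lambda rho T = end_count B r T.
  by rewrite /count_words counting_esum.
have [C2 C20 HC2] := end_count_le wp BA rG del0 Zd1 ZD.
have [C1 C10 [T0 HC1]] := end_count_ge wp BA Bl rG del0 Zd1 ZD sdel Zs1.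
have e0 T : 0 < expR (del * T) by exact: expR_gt0.
have ratioE T : ratio T = (end_count B r T * ((expR (del * T))^-1)%:E)%E.
  by rewrite /ratio countE deltaE -EFinM/= inver gt_eqF.
exists C1, C2; split => //; split.
- apply: limf_einf_ge; near=> T.
  rewrite ratioE lee_pdivlMr// -EFinM; apply: HC1.
  by near: T; apply: nbhs_pinfty_ge; exact: num_real.
- exact: limf_einf_le_esup.
- apply: limf_esup_le; near=> T.
  by rewrite ratioE lee_pdivrMr// -EFinM.
Unshelve. all: by end_near. Qed.

End Symbolic.

Theorem theorem3 (R : realType) (d : nat) (E : countType) (A : rel E)
  (X : set 'rV[R]_d) (phi : E -> 'rV[R]_d -> 'rV[R]_d) (kappa L alpha : R)
  (a : nat) (z : 'I_a.+1 -> R[i]) (nu : probability (Lambda a) R)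
  (lambda : int -> 'I_a.+1) (l : 'I_a -> R) :
  d = 1%N \/ d = 2%N ->
  is_CIFS X phi kappa L alpha ->
  finitely_irreducible A ->
  strongly_regular A (potential X phi) ->
  alphabet_ok d z ->
  bernoulli_measure nu ->
  (exists kappa' L' alpha' : R,
     {ae nu, forall mu : int -> 'I_a.+1,
        is_CIFS X (fun e x => complex_scale (z (mu 0)) (phi e x)) kappa' L' alpha'}) ->
  bounded_fluctuation lambda l ->
  strongly_regular A (fun rho => potential X phi rho + mean_log z l) ->
  forall rho : nat -> E, seqs A rho ->
  let delta := abscissa A (potential X phi) z lambda rho in
  let ratio (T : R) : \bar R :=
    (count_words A (potential X phi) z lambda rho T / expeR (delta * T%:E))%E in
  exists C D : R, [/\ 0 < C, 0 < D &
    [/\ (C%:E <= limf_einf ratio (pinfty_nbhs R))%E,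
        (limf_einf ratio (pinfty_nbhs R) <= limf_esup ratio (pinfty_nbhs R))%E &
        (limf_esup ratio (pinfty_nbhs R) <= D%:E)%E]].
Proof.
move=> d12 cifs Airr _ [_ [eps eps0 zeps] _] _ _ bf greg.
have d0 : (0 < d)%N by case: d12 => ->.
have [K HK] := birkhoff_distortion (A := A) d0 cifs.
(* Contraction by [kappa < 1] provides the decay rate per letter. *)
apply: (random_counting (b := - ln kappa) _ _ HK Airr _ bf greg).
- by have /andP[k0 k1] := cifs_kappa cifs; rewrite oppr_gt0 ln_lt0// k0.
- by move=> tau _; rewrite opprK; exact: potential_le d0 cifs tau.
- by move=> i; have /andP[ez ->] := zeps i; rewrite (lt_trans eps0 ez).
Qed.
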